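(* There is an isomorphism between (locally globular) Gray categories and locally cubical Gray categories having only trivial horizontal $2$-cells (that is, in which every horizontal $2$-cell is an identity $U_f$ on a $1$-cell $f$).
   Context: All compositions are written in diagrammatic (left-to-right) order. ''Isomorphism'' refers to the two kinds of structure: a one-to-one correspondence under which $0$-cells, $1$-cells, $2$-cells (vertical $2$-cells in the cubical case), $3$-cells, and all composition, whiskering and interchanger operations correspond. **Double categories.** A (weak) double category $\mathbb D$ consists of categories $\mathbb D_0,\mathbb D_1$ and functors $L,R:\mathbb D_1\to\mathbb D_0$, $U:\mathbb D_0\to\mathbb D_1$, $\odot:\mathbb D_1\times_{\mathbb D_0}\mathbb D_1\to\mathbb D_1$ (pullback of $R$ and $L$) with $L(U_A)=A=R(U_A)$, $L(M\odot N)=L(M)$, $R(M\odot N)=R(N)$ (also on morphisms), and natural isomorphisms $\lambda_M:U_{LM}\odot M\to M$, $\rho_M:M\odot U_{RM}\to M$, $\kappa_{M,N,P}:(M\odot N)\odot P\to M\odot(N\odot P)$, whose images under $L$ and $R$ are identities, satisfying Mac Lane's pentagon and triangle equations. Objects and morphisms of $\mathbb D_0$ are the objects and arrows of $\mathbb D$; objects of $\mathbb D_1$ are proarrows $M:A⇸B$ (meaning $L(M)=A$, $R(M)=B$); morphisms of $\mathbb D_1$ are squares. A square $\varphi$ with left arrow $f=L(\varphi)$, right arrow $g=R(\varphi)$, top proarrow (domain) $M$ and bottom proarrow (codomain) $N$ is written $\varphi:(f,g;M,N)$. Composition in $\mathbb D_0$ and $\mathbb D_1$ is written $\cdot$, with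 identities $\mathrm{id}$. An arrow disk $f⇸g$ is a square $(f,g;U,U)$; a proarrow disk $M\to N$ is a square $(\mathrm{id},\mathrm{id};M,N)$. All double categories are assumed preunitary: $U_A\odot U_A=U_A$ and $\lambda_{U_A}=\mathrm{id}_{U_A}=\rho_{U_A}$. For squares $\varphi:(f,g;M\odot U,N\odot U)$ and $\psi:(f,g;U\odot M,U\odot N)$, write $\varphi\cong\psi$ for $\rho_M^{-1}\cdot\varphi\cdot\rho_N=\lambda_M^{-1}\cdot\psi\cdot\lambda_N$ (and likewise with the two sides exchanged). **Locally cubical Gray category** $\mathcal C$ (with preunitary weak homs, and oplax in both dimensions). The data are: (i) a collection of $0$-cells, and for each pair of $0$-cells $A,B$ a preunitary double category $\mathcal C(A,B)$, whose objects, arrows, proarrows and squares are called $1$-cells, vertical $2$-cells, horizontal $2$-cells and $3$-cells; (ii) identity $1$-cells $\mathrm{Id}_A:A\to A$ and composites $f\circledast g:A\to C$ for $f:A\to B$, $g:B\to C$; and for $1$-cells $a:A'\to A$, $b:B\to B'$ and any cell $x$ (vertical $2$-cell, horizontal $2$-cell or $3$-cell) of $\mathcal C(A,B)$, whiskered cells $a\circledast x$ and $x\circledast b$ of the same kind, whose boundaries are the whiskerings of the boundaries of $x$; (iii) interchanger $3$-cells: writing $\alpha:f\to f'$ vertical and $\gamma:f⇸f'$ horizontal in $\mathcal C(A,B)$, and $\beta:g\to g'$ vertical and $\delta:g⇸g'$ horizontal in $\mathcal C(B,C)$, $\chi(\alpha,\delta):(\alpha\circledast g,\ \alpha\circledast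 g';\ f\circledast\delta,\ f'\circledast\delta)$; $\chi(\gamma,\beta):(f\circledast\beta,\ f'\circledast\beta;\ \gamma\circledast g,\ \gamma\circledast g')$; $\chi(\alpha,\beta):(\alpha\circledast g)\cdot(f'\circledast\beta)⇸(f\circledast\beta)\cdot(\alpha\circledast g')$ (arrow disk); $\chi(\gamma,\delta):(\gamma\circledast g)\odot(f'\circledast\delta)\to(f\circledast\delta)\odot(\gamma\circledast g')$ (proarrow disk). The whiskering laws are: $\mathrm{Id}_A\circledast x=x=x\circledast\mathrm{Id}_B$; $(a'\circledast a)\circledast x=a'\circledast(a\circledast x)$; $x\circledast(b\circledast b')=(x\circledast b)\circledast b'$; $(a\circledast x)\circledast b=a\circledast(x\circledast b)$ (for all cells $x$, including $1$-cells); and $a\circledast-$ and $-\circledast b$ strictly preserve all local double category structure: $\cdot$, $\mathrm{id}$, $\odot$, $U$, $\lambda,\rho,\kappa$. The interchanger laws are as follows. (1) Whiskering, for $2$-cells $x,y$ each vertical or horizontal and suitable $1$-cells $a,b,c$: $\chi(a\circledast x,y)=a\circledast\chi(x,y)$, $\chi(x,y\circledast c)=\chi(x,y)\circledast c$, $\chi(x\circledast b,y)=\chi(x,b\circledast y)$. (2) Vertical–horizontal, for $\alpha:f\to f'$, $\alpha':f'\to f''$, $\delta:g⇸g'$, $\delta':g'⇸g''$: $\chi(\mathrm{id}_f,\delta)=\mathrm{id}_{f\circledast\delta}$, $\chi(\alpha\cdot\alpha',\delta)=\chi(\alpha,\delta)\cdot\chi(\alpha',\delta)$, $\chi(\alpha,U_g)=U_{\alpha\circledast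 g}$, $\chi(\alpha,\delta\odot\delta')=\chi(\alpha,\delta)\odot\chi(\alpha,\delta')$. (3) Horizontal–vertical, for $\gamma:f⇸f'$, $\gamma':f'⇸f''$, $\beta:g\to g'$, $\beta':g'\to g''$: $\chi(U_f,\beta)=U_{f\circledast\beta}$, $\chi(\gamma\odot\gamma',\beta)=\chi(\gamma,\beta)\odot\chi(\gamma',\beta)$, $\chi(\gamma,\mathrm{id}_g)=\mathrm{id}_{\gamma\circledast g}$, $\chi(\gamma,\beta\cdot\beta')=\chi(\gamma,\beta)\cdot\chi(\gamma,\beta')$. (4) Vertical–vertical: $\chi(\mathrm{id}_f,\beta)=U_{f\circledast\beta}$, $\chi(\alpha,\mathrm{id}_g)=U_{\alpha\circledast g}$, $\chi(\alpha\cdot\alpha',\beta)=(U_{\alpha\circledast g}\cdot\chi(\alpha',\beta))\odot(\chi(\alpha,\beta)\cdot U_{\alpha'\circledast g'})$, $\chi(\alpha,\beta\cdot\beta')=(\chi(\alpha,\beta)\cdot U_{f'\circledast\beta'})\odot(U_{f\circledast\beta}\cdot\chi(\alpha,\beta'))$. (5) Horizontal–horizontal: $\chi(U_f,\delta)=\lambda\cdot\rho^{-1}$, $\chi(\gamma,U_g)=\rho\cdot\lambda^{-1}$, $\chi(\gamma\odot\gamma',\delta)=\kappa\cdot(\mathrm{id}_{\gamma\circledast g}\odot\chi(\gamma',\delta))\cdot\kappa^{-1}\cdot(\chi(\gamma,\delta)\odot\mathrm{id}_{\gamma'\circledast g'})\cdot\kappa$, $\chi(\gamma,\delta\odot\delta')=\kappa^{-1}\cdot(\chi(\gamma,\delta)\odot\mathrm{id}_{f'\circledast\delta'})\cdot\kappa\cdot(\mathrm{id}_{f\circledast\delta}\odot\chi(\gamma,\delta'))\cdot\kappa^{-1}$,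 with evident indices. (6) Naturality in the first index, for $\varphi:(\alpha,\alpha';\gamma,\gamma')$ in $\mathcal C(A,B)$ and $\delta:g⇸g'$, $\beta:g\to g'$ in $\mathcal C(B,C)$: $((\varphi\circledast g)\odot\chi(\alpha',\delta))\cdot\chi(\gamma',\delta)=\chi(\gamma,\delta)\cdot(\chi(\alpha,\delta)\odot(\varphi\circledast g'))$ and $((\varphi\circledast g)\cdot\chi(\gamma',\beta))\odot\chi(\alpha',\beta)\cong\chi(\alpha,\beta)\odot(\chi(\gamma,\beta)\cdot(\varphi\circledast g'))$. (7) Naturality in the last index, for $\psi:(\beta,\beta';\delta,\delta')$ in $\mathcal C(B,C)$ and $\gamma:f⇸f'$, $\alpha:f\to f'$ in $\mathcal C(A,B)$: $\chi(\gamma,\delta)\cdot((f\circledast\psi)\odot\chi(\gamma,\beta'))=(\chi(\gamma,\beta)\odot(f'\circledast\psi))\cdot\chi(\gamma,\delta')$ and $\chi(\alpha,\beta)\odot((f\circledast\psi)\cdot\chi(\alpha,\delta'))\cong(\chi(\alpha,\delta)\cdot(f'\circledast\psi))\odot\chi(\alpha,\beta')$. **(Locally globular) Gray category** $\mathcal G$ (of the corresponding oplax variance; interchangers are directed and not required to be invertible), i.e. a category enriched in $2$-categories with the Gray tensor product. It has: a collection of $0$-cells; for each pair $A,B$ a strict $2$-category $\mathcal G(A,B)$ whose objects, $1$-morphisms and $2$-morphisms are the $1$-cells, $2$-cells $\alpha:f\to f'$ and $3$-cells $\varphi:\alpha\Rightarrow\alpha'$ of $\mathcal G$ (composition of $1$-morphisms,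 and composition of $2$-morphisms along objects, is written $\cdot$; composition of $2$-morphisms along $1$-morphisms is written $\odot$; $1_\alpha$ is the identity $2$-morphism on $\alpha$); identity $1$-cells $\mathrm{Id}_A$ and composites $f\circledast g$; whiskerings $a\circledast-$ and $-\circledast b$ that are strict $2$-functors and satisfy $\mathrm{Id}_A\circledast x=x=x\circledast\mathrm{Id}_B$, $(a'\circledast a)\circledast x=a'\circledast(a\circledast x)$, $x\circledast(b\circledast b')=(x\circledast b)\circledast b'$, $(a\circledast x)\circledast b=a\circledast(x\circledast b)$; and for $2$-cells $\alpha:f\to f'$ in $\mathcal G(A,B)$ and $\beta:g\to g'$ in $\mathcal G(B,C)$ an interchanger $3$-cell $\chi(\alpha,\beta):(\alpha\circledast g)\cdot(f'\circledast\beta)\Rightarrow(f\circledast\beta)\cdot(\alpha\circledast g')$ satisfying: $\chi(a\circledast\alpha,\beta)=a\circledast\chi(\alpha,\beta)$, $\chi(\alpha,\beta\circledast c)=\chi(\alpha,\beta)\circledast c$, $\chi(\alpha\circledast b,\beta)=\chi(\alpha,b\circledast\beta)$; $\chi(\mathrm{id}_f,\beta)=1_{f\circledast\beta}$, $\chi(\alpha,\mathrm{id}_g)=1_{\alpha\circledast g}$, $\chi(\alpha\cdot\alpha',\beta)=(1_{\alpha\circledast g}\cdot\chi(\alpha',\beta))\odot(\chi(\alpha,\beta)\cdot1_{\alpha'\circledast g'})$, $\chi(\alpha,\beta\cdot\beta')=(\chi(\alpha,\beta)\cdot1_{f'\circledast\beta'})\odot(1_{f\circledast\beta}\cdot\chi(\alpha,\beta'))$;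 and, for $3$-cells $\varphi:\alpha\Rightarrow\alpha'$ and $\psi:\beta\Rightarrow\beta'$, $((\varphi\circledast g)\cdot1_{f'\circledast\beta})\odot\chi(\alpha',\beta)=\chi(\alpha,\beta)\odot(1_{f\circledast\beta}\cdot(\varphi\circledast g'))$ and $\chi(\alpha,\beta)\odot((f\circledast\psi)\cdot1_{\alpha\circledast g'})=(1_{\alpha\circledast g}\cdot(f'\circledast\psi))\odot\chi(\alpha,\beta')$. *)

(* Defs.v *)
From mathcomp Require Import ssreflect ssrfun.

Set Implicit Arguments.
Unset Strict Implicit.
Unset Printing Implicit Defensive.

(* All compositions are in diagrammatic order.  Cells are families indexed by  *)
(* their boundaries.  Laws whose two sides have provably, but not              *)
(* definitionally, equal boundaries are stated with [heq2], [mor2_eq] and      *)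
(* [sq_eq], which assert that the boundaries agree and that the cells agree    *)
(* over them.  The sources and targets of 1-cells never need to be identified, *)
(* since the equations between 0-cells that occur hold by conversion.          *)
Inductive heq2 {T : Type} {F : T -> T -> Type} {a b : T} (x : F a b) :
  forall a' b' : T, F a' b' -> Prop :=
| heq2_refl : heq2 x x.
Arguments heq2 {T F a b} x {a' b'} _.

Declare Scope dbl_scope.
Declare Scope two_scope.
Delimit Scope dbl_scope with dbl.
Delimit Scope two_scope with two.

Reserved Notation "f · g" (at level 40, left associativity).
Reserved Notation "M ⊙ N" (at level 40, left associativity).
Reserved Notation "s ·□ t" (at level 40, left associativity).
Reserved Notation "s ⊙□ t" (at level 40, left associativity).
Reserved Notation "s ⊙□[ e ] t" (at level 40, left associativity).
Reserved Notation "s ·2 t" (at level 40, left associativity).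
Reserved Notation "s ⊙[ e ] t" (at level 40, left associativity).
Reserved Notation "f ⊛ g" (at level 38, left associativity).
Reserved Notation "a ◁v x" (at level 38, left associativity).
Reserved Notation "x ▷v b" (at level 38, left associativity).
Reserved Notation "a ◁h x" (at level 38, left associativity).
Reserved Notation "x ▷h b" (at level 38, left associativity).
Reserved Notation "a ◁s x" (at level 38, left associativity).
Reserved Notation "x ▷s b" (at level 38, left associativity).
Reserved Notation "a ◁2 x" (at level 38, left associativity).
Reserved Notation "x ▷2 b" (at level 38, left associativity).
Reserved Notation "a ◁3 x" (at level 38, left associativity).
Reserved Notation "x ▷3 b" (at level 38, left associativity).

(* [pro A B] consists of the M in D_1 with L M = A and R M = B, and            *)
(* [sq f g M N] of the squares (f, g; M, N).  So the functoriality of L and R, *)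
(* their values on units and composites, and the fact that the components of   *)
(* lambda, rho and kappa are globular, hold by typing.                         *)
Record double_graph := DoubleGraph {
  obj : Type;
  arr : obj -> obj -> Type;
  pro : obj -> obj -> Type;
  sq : forall {A B A' B' : obj},
    arr A A' -> arr B B' -> pro A B -> pro A' B' -> Type
}.
Arguments arr {_} _ _.
Arguments pro {_} _ _.
Arguments sq {_ A B A' B'} _ _ _ _.

Inductive sq_eq {D : double_graph} {A B A' B' : obj D}
    {f : arr A A'} {g : arr B B'} {M : pro A B} {N : pro A' B'}
    (s : sq f g M N) :
  forall (X Y X' Y' : obj D) (f' : arr X X') (g' : arr Y Y')
    (M' : pro X Y) (N' : pro X' Y'), sq f' g' M' N' -> Prop :=
| sq_eq_refl : sq_eq s s.
Arguments sq_eq {D A B A' B' f g M N} s {X Y X' Y' f' g' M' N'} _.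

Record double_ops := DoubleOps {
  dgraph :> double_graph;
  aid : forall A : obj dgraph, arr A A;
  acomp : forall {A B C : obj dgraph}, arr A B -> arr B C -> arr A C;
  sid : forall {A B : obj dgraph} (M : pro A B), sq (aid A) (aid B) M M;
  scomp : forall {A B A' B' A'' B'' : obj dgraph}
    {f : arr A A'} {g : arr B B'} {f' : arr A' A''} {g' : arr B' B''}
    {M : pro A B} {N : pro A' B'} {P : pro A'' B''},
    sq f g M N -> sq f' g' N P -> sq (acomp f f') (acomp g g') M P;
  punit : forall A : obj dgraph, pro A A;
  sunit : forall {A B : obj dgraph} (f : arr A B),
    sq f f (punit A) (punit B);
  pcomp : forall {A B C : obj dgraph}, pro A B -> pro B C -> pro A C;
  shcomp : forall {A B C A' B' C' : obj dgraph}
    {f : arr A A'} {g : arr B B'} {h : arr C C'}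
    {M : pro A B} {M' : pro B C} {N : pro A' B'} {N' : pro B' C'},
    sq f g M N -> sq g h M' N' -> sq f h (pcomp M M') (pcomp N N');
  lam : forall {A B : obj dgraph} (M : pro A B),
    sq (aid A) (aid B) (pcomp (punit A) M) M;
  lam_inv : forall {A B : obj dgraph} (M : pro A B),
    sq (aid A) (aid B) M (pcomp (punit A) M);
  rho : forall {A B : obj dgraph} (M : pro A B),
    sq (aid A) (aid B) (pcomp M (punit B)) M;
  rho_inv : forall {A B : obj dgraph} (M : pro A B),
    sq (aid A) (aid B) M (pcomp M (punit B));
  kap : forall {A B C E : obj dgraph}
    (M : pro A B) (N : pro B C) (P : pro C E),
    sq (aid A) (aid E) (pcomp (pcomp M N) P) (pcomp M (pcomp N P));
  kap_inv : forall {A B C E : obj dgraph}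
    (M : pro A B) (N : pro B C) (P : pro C E),
    sq (aid A) (aid E) (pcomp M (pcomp N P)) (pcomp (pcomp M N) P)
}.
Arguments aid {_} A.
Arguments acomp {_ A B C} _ _.
Arguments sid {_ A B} M.
Arguments scomp {_ A B A' B' A'' B'' f g f' g' M N P} _ _.
Arguments punit {_} A.
Arguments sunit {_ A B} f.
Arguments pcomp {_ A B C} _ _.
Arguments shcomp {_ A B C A' B' C' f g h M M' N N'} _ _.
Arguments lam {_ A B} M.
Arguments lam_inv {_ A B} M.
Arguments rho {_ A B} M.
Arguments rho_inv {_ A B} M.
Arguments kap {_ A B C E} M N P.
Arguments kap_inv {_ A B C E} M N P.

Notation "f · g" := (acomp f g) : dbl_scope.
Notation "M ⊙ N" := (pcomp M N) : dbl_scope.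
Notation "s ·□ t" := (scomp s t) : dbl_scope.
Notation "s ⊙□ t" := (shcomp s t) : dbl_scope.

Open Scope dbl_scope.

Record double_laws (D : double_ops) : Prop := DoubleLaws {
  aid_l : forall (A B : obj D) (f : arr A B), aid A · f = f;
  aid_r : forall (A B : obj D) (f : arr A B), f · aid B = f;
  acompA : forall (A B C E : obj D) (f : arr A B) (g : arr B C) (h : arr C E),
    f · (g · h) = (f · g) · h;
  sid_l : forall (A B A' B' : obj D) (f : arr A A') (g : arr B B')
    (M : pro A B) (N : pro A' B') (s : sq f g M N), sq_eq (sid M ·□ s) s;
  sid_r : forall (A B A' B' : obj D) (f : arr A A') (g : arr B B')
    (M : pro A B) (N : pro A' B') (s : sq f g M N), sq_eq (s ·□ sid N) s;
  scompA : forall (A B A' B' A'' B'' X Y : obj D)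
    (f : arr A A') (g : arr B B') (f' : arr A' A'') (g' : arr B' B'')
    (f'' : arr A'' X) (g'' : arr B'' Y)
    (M : pro A B) (N : pro A' B') (P : pro A'' B'') (Q : pro X Y)
    (s : sq f g M N) (t : sq f' g' N P) (u : sq f'' g'' P Q),
    sq_eq (s ·□ (t ·□ u)) ((s ·□ t) ·□ u);
  sunit_aid : forall A : obj D, sunit (aid A) = sid (punit A);
  sunit_acomp : forall (A B C : obj D) (f : arr A B) (g : arr B C),
    sunit (f · g) = sunit f ·□ sunit g;
  shcomp_sid : forall (A B C : obj D) (M : pro A B) (N : pro B C),
    sid M ⊙□ sid N = sid (M ⊙ N);
  shcomp_scomp : forall (A B C A' B' C' A'' B'' C'' : obj D)
    (f : arr A A') (g : arr B B') (h : arr C C')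
    (f' : arr A' A'') (g' : arr B' B'') (h' : arr C' C'')
    (M : pro A B) (N : pro B C) (M' : pro A' B') (N' : pro B' C')
    (M'' : pro A'' B'') (N'' : pro B'' C'')
    (s : sq f g M M') (t : sq g h N N')
    (s' : sq f' g' M' M'') (t' : sq g' h' N' N''),
    (s ·□ s') ⊙□ (t ·□ t') = (s ⊙□ t) ·□ (s' ⊙□ t');
  lam_linv : forall (A B : obj D) (M : pro A B),
    sq_eq (lam M ·□ lam_inv M) (sid (punit A ⊙ M));
  lam_rinv : forall (A B : obj D) (M : pro A B),
    sq_eq (lam_inv M ·□ lam M) (sid M);
  rho_linv : forall (A B : obj D) (M : pro A B),
    sq_eq (rho M ·□ rho_inv M) (sid (M ⊙ punit B));
  rho_rinv : forall (A B : obj D) (M : pro A B),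
    sq_eq (rho_inv M ·□ rho M) (sid M);
  kap_linv : forall (A B C E : obj D)
    (M : pro A B) (N : pro B C) (P : pro C E),
    sq_eq (kap M N P ·□ kap_inv M N P) (sid ((M ⊙ N) ⊙ P));
  kap_rinv : forall (A B C E : obj D)
    (M : pro A B) (N : pro B C) (P : pro C E),
    sq_eq (kap_inv M N P ·□ kap M N P) (sid (M ⊙ (N ⊙ P)));
  lam_nat : forall (A B A' B' : obj D) (f : arr A A') (g : arr B B')
    (M : pro A B) (N : pro A' B') (s : sq f g M N),
    sq_eq ((sunit f ⊙□ s) ·□ lam N) (lam M ·□ s);
  rho_nat : forall (A B A' B' : obj D) (f : arr A A') (g : arr B B')
    (M : pro A B) (N : pro A' B') (s : sq f g M N),
    sq_eq ((s ⊙□ sunit g) ·□ rho N) (rho M ·□ s);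
  kap_nat : forall (A B C E A' B' C' E' : obj D)
    (f : arr A A') (g : arr B B') (h : arr C C') (k : arr E E')
    (M : pro A B) (N : pro B C) (P : pro C E)
    (M' : pro A' B') (N' : pro B' C') (P' : pro C' E')
    (s : sq f g M M') (t : sq g h N N') (u : sq h k P P'),
    sq_eq (((s ⊙□ t) ⊙□ u) ·□ kap M' N' P') (kap M N P ·□ (s ⊙□ (t ⊙□ u)));
  triangle : forall (A B C : obj D) (M : pro A B) (N : pro B C),
    sq_eq (kap M (punit B) N ·□ (sid M ⊙□ lam N)) (rho M ⊙□ sid N);
  pentagon : forall (A B C E X : obj D)
    (M : pro A B) (N : pro B C) (P : pro C E) (Q : pro E X),
    sq_eq (kap (M ⊙ N) P Q ·□ kap M N (P ⊙ Q))
      (((kap M N P ⊙□ sid Q) ·□ kap M (N ⊙ P) Q) ·□ (sid M ⊙□ kap N P Q));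
  punit_idem : forall A : obj D, punit A ⊙ punit A = punit A;
  lam_punit : forall A : obj D, sq_eq (lam (punit A)) (sid (punit A));
  rho_punit : forall A : obj D, sq_eq (rho (punit A)) (sid (punit A))
}.

Record double_category := DoubleCategory {
  dops :> double_ops;
  dlaws : double_laws dops
}.

(* Associativity of vertical composition is only propositional, so the squares *)
(* composed in the vertical-vertical interchanger laws need a transport.       *)
Definition shcomp_along {D : double_ops} {A B C A' B' C' : obj D}
    {f : arr A A'} {g g' : arr B B'} {h : arr C C'}
    {M : pro A B} {M' : pro B C} {N : pro A' B'} {N' : pro B' C'}
    (e : g = g') (s : sq f g M N) (t : sq g' h M' N') :
    sq f h (M ⊙ M') (N ⊙ N') :=
  match e in _ = k return sq k h M' N' -> sq f h (M ⊙ M') (N ⊙ N') with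
  | eq_refl => fun t => s ⊙□ t
  end t.
Notation "s ⊙□[ e ] t" := (shcomp_along e s t) : dbl_scope.

(* The relation usually denoted by a congruence sign; both sides lie over      *)
(* ((id . f) . id, (id . g) . id; M, N), so plain equality applies.            *)
Definition sq_cong {D : double_ops} {A B A' B' : obj D}
    {f : arr A A'} {g : arr B B'} {M : pro A B} {N : pro A' B'}
    (s : sq f g (M ⊙ punit B) (N ⊙ punit B'))
    (t : sq f g (punit A ⊙ M) (punit A' ⊙ N)) : Prop :=
  (rho_inv M ·□ s) ·□ rho N = (lam_inv M ·□ t) ·□ lam N.

Record strict_double_functor (D E : double_ops) (Fo : obj D -> obj E)
    (Fa : forall A B : obj D, arr A B -> arr (Fo A) (Fo B))
    (Fp : forall A B : obj D, pro A B -> pro (Fo A) (Fo B))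
    (Fs : forall (A B A' B' : obj D) (f : arr A A') (g : arr B B')
      (M : pro A B) (N : pro A' B'),
      sq f g M N -> sq (Fa _ _ f) (Fa _ _ g) (Fp _ _ M) (Fp _ _ N)) : Prop :=
StrictDoubleFunctor {
  sdf_aid : forall A : obj D, Fa A A (aid A) = aid (Fo A);
  sdf_acomp : forall (A B C : obj D) (f : arr A B) (g : arr B C),
    Fa _ _ (f · g) = Fa _ _ f · Fa _ _ g;
  sdf_sid : forall (A B : obj D) (M : pro A B),
    sq_eq (Fs _ _ _ _ _ _ _ _ (sid M)) (sid (Fp _ _ M));
  sdf_scomp : forall (A B A' B' A'' B'' : obj D)
    (f : arr A A') (g : arr B B') (f' : arr A' A'') (g' : arr B' B'')
    (M : pro A B) (N : pro A' B') (P : pro A'' B'')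
    (s : sq f g M N) (t : sq f' g' N P),
    sq_eq (Fs _ _ _ _ _ _ _ _ (s ·□ t))
      (Fs _ _ _ _ _ _ _ _ s ·□ Fs _ _ _ _ _ _ _ _ t);
  sdf_punit : forall A : obj D, Fp A A (punit A) = punit (Fo A);
  sdf_sunit : forall (A B : obj D) (f : arr A B),
    sq_eq (Fs _ _ _ _ _ _ _ _ (sunit f)) (sunit (Fa _ _ f));
  sdf_pcomp : forall (A B C : obj D) (M : pro A B) (N : pro B C),
    Fp _ _ (M ⊙ N) = Fp _ _ M ⊙ Fp _ _ N;
  sdf_shcomp : forall (A B C A' B' C' : obj D)
    (f : arr A A') (g : arr B B') (h : arr C C')
    (M : pro A B) (M' : pro B C) (N : pro A' B') (N' : pro B' C')
    (s : sq f g M N) (t : sq g h M' N'),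
    sq_eq (Fs _ _ _ _ _ _ _ _ (s ⊙□ t))
      (Fs _ _ _ _ _ _ _ _ s ⊙□ Fs _ _ _ _ _ _ _ _ t);
  sdf_lam : forall (A B : obj D) (M : pro A B),
    sq_eq (Fs _ _ _ _ _ _ _ _ (lam M)) (lam (Fp _ _ M));
  sdf_rho : forall (A B : obj D) (M : pro A B),
    sq_eq (Fs _ _ _ _ _ _ _ _ (rho M)) (rho (Fp _ _ M));
  sdf_kap : forall (A B C X : obj D)
    (M : pro A B) (N : pro B C) (P : pro C X),
    sq_eq (Fs _ _ _ _ _ _ _ _ (kap M N P))
      (kap (Fp _ _ M) (Fp _ _ N) (Fp _ _ P))
}.

(* The suffixes v, h, s stand for vertical 2-cells, horizontal 2-cells and     *)
(* squares; [a ◁. x] and [x ▷. b] whisker the cell x by the 1-cells a and b.   *)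
Record cubical_ops := CubicalOps {
  ccell0 : Type;
  chom : ccell0 -> ccell0 -> double_category;
  cId : forall A : ccell0, obj (chom A A);
  ccomp : forall {A B C : ccell0},
    obj (chom A B) -> obj (chom B C) -> obj (chom A C);
  clv : forall {A B C : ccell0} (a : obj (chom A B)) {f f' : obj (chom B C)},
    arr f f' -> arr (ccomp a f) (ccomp a f');
  crv : forall {A B C : ccell0} {f f' : obj (chom A B)},
    arr f f' -> forall b : obj (chom B C), arr (ccomp f b) (ccomp f' b);
  clh : forall {A B C : ccell0} (a : obj (chom A B)) {f f' : obj (chom B C)},
    pro f f' -> pro (ccomp a f) (ccomp a f');
  crh : forall {A B C : ccell0} {f f' : obj (chom A B)},
    pro f f' -> forall b : obj (chom B C), pro (ccomp f b) (ccomp f' b);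
  cls : forall {A B C : ccell0} (a : obj (chom A B))
    {f g f' g' : obj (chom B C)} {x : arr f f'} {y : arr g g'}
    {m : pro f g} {n : pro f' g'},
    sq x y m n -> sq (clv a x) (clv a y) (clh a m) (clh a n);
  crs : forall {A B C : ccell0} {f g f' g' : obj (chom A B)}
    {x : arr f f'} {y : arr g g'} {m : pro f g} {n : pro f' g'},
    sq x y m n -> forall b : obj (chom B C),
    sq (crv x b) (crv y b) (crh m b) (crh n b);
  chi_vh : forall {A B C : ccell0} {f f' : obj (chom A B)}
    {g g' : obj (chom B C)} (x : arr f f') (d : pro g g'),
    sq (crv x g) (crv x g') (clh f d) (clh f' d);
  chi_hv : forall {A B C : ccell0} {f f' : obj (chom A B)}
    {g g' : obj (chom B C)} (c : pro f f') (y : arr g g'),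
    sq (clv f y) (clv f' y) (crh c g) (crh c g');
  chi_vv : forall {A B C : ccell0} {f f' : obj (chom A B)}
    {g g' : obj (chom B C)} (x : arr f f') (y : arr g g'),
    sq (crv x g · clv f' y) (clv f y · crv x g')
      (punit (ccomp f g)) (punit (ccomp f' g'));
  chi_hh : forall {A B C : ccell0} {f f' : obj (chom A B)}
    {g g' : obj (chom B C)} (c : pro f f') (d : pro g g'),
    sq (aid (ccomp f g)) (aid (ccomp f' g'))
      (crh c g ⊙ clh f' d) (clh f d ⊙ crh c g')
}.
Arguments chom {_} _ _.
Arguments cId {_} A.
Arguments ccomp {_ A B C} _ _.
Arguments clv {_ A B C} a {f f'} _.
Arguments crv {_ A B C f f'} _ b.
Arguments clh {_ A B C} a {f f'} _.
Arguments crh {_ A B C f f'} _ b.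
Arguments cls {_ A B C} a {f g f' g' x y m n} _.
Arguments crs {_ A B C f g f' g' x y m n} _ b.
Arguments chi_vh {_ A B C f f' g g'} x d.
Arguments chi_hv {_ A B C f f' g g'} c y.
Arguments chi_vv {_ A B C f f' g g'} x y.
Arguments chi_hh {_ A B C f f' g g'} c d.

Notation "f ⊛ g" := (ccomp f g) : dbl_scope.
Notation "a ◁v x" := (clv a x) : dbl_scope.
Notation "x ▷v b" := (crv x b) : dbl_scope.
Notation "a ◁h x" := (clh a x) : dbl_scope.
Notation "x ▷h b" := (crh x b) : dbl_scope.
Notation "a ◁s x" := (cls a x) : dbl_scope.
Notation "x ▷s b" := (crs x b) : dbl_scope.

Record cubical_whisker_laws (C : cubical_ops) : Prop := CubicalWhiskerLaws {
  cid_l1 : forall (A B : ccell0 C) (f : obj (chom A B)), cId A ⊛ f = f;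
  cid_r1 : forall (A B : ccell0 C) (f : obj (chom A B)), f ⊛ cId B = f;
  cassoc1 : forall (X A B Y : ccell0 C) (f : obj (chom X A))
    (g : obj (chom A B)) (h : obj (chom B Y)), f ⊛ (g ⊛ h) = (f ⊛ g) ⊛ h;
  cid_lv : forall (A B : ccell0 C) (f f' : obj (chom A B)) (x : arr f f'),
    heq2 (cId A ◁v x) x;
  cid_rv : forall (A B : ccell0 C) (f f' : obj (chom A B)) (x : arr f f'),
    heq2 (x ▷v cId B) x;
  cid_lh : forall (A B : ccell0 C) (f f' : obj (chom A B)) (x : pro f f'),
    heq2 (cId A ◁h x) x;
  cid_rh : forall (A B : ccell0 C) (f f' : obj (chom A B)) (x : pro f f'),
    heq2 (x ▷h cId B) x;
  cid_ls : forall (A B : ccell0 C) (f g f' g' : obj (chom A B))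
    (x : arr f f') (y : arr g g') (m : pro f g) (n : pro f' g')
    (s : sq x y m n), sq_eq (cId A ◁s s) s;
  cid_rs : forall (A B : ccell0 C) (f g f' g' : obj (chom A B))
    (x : arr f f') (y : arr g g') (m : pro f g) (n : pro f' g')
    (s : sq x y m n), sq_eq (s ▷s cId B) s;
  cassoc_llv : forall (A'' A' A B : ccell0 C) (a' : obj (chom A'' A'))
    (a : obj (chom A' A)) (f f' : obj (chom A B)) (x : arr f f'),
    heq2 ((a' ⊛ a) ◁v x) (a' ◁v (a ◁v x));
  cassoc_llh : forall (A'' A' A B : ccell0 C) (a' : obj (chom A'' A'))
    (a : obj (chom A' A)) (f f' : obj (chom A B)) (x : pro f f'),
    heq2 ((a' ⊛ a) ◁h x) (a' ◁h (a ◁h x));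
  cassoc_lls : forall (A'' A' A B : ccell0 C) (a' : obj (chom A'' A'))
    (a : obj (chom A' A)) (f g f' g' : obj (chom A B))
    (x : arr f f') (y : arr g g') (m : pro f g) (n : pro f' g')
    (s : sq x y m n), sq_eq ((a' ⊛ a) ◁s s) (a' ◁s (a ◁s s));
  cassoc_rrv : forall (A B B' B'' : ccell0 C) (f f' : obj (chom A B))
    (x : arr f f') (b : obj (chom B B')) (b' : obj (chom B' B'')),
    heq2 (x ▷v (b ⊛ b')) ((x ▷v b) ▷v b');
  cassoc_rrh : forall (A B B' B'' : ccell0 C) (f f' : obj (chom A B))
    (x : pro f f') (b : obj (chom B B')) (b' : obj (chom B' B'')),
    heq2 (x ▷h (b ⊛ b')) ((x ▷h b) ▷h b');
  cassoc_rrs : forall (A B B' B'' : ccell0 C) (f g f' g' : obj (chom A B))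
    (x : arr f f') (y : arr g g') (m : pro f g) (n : pro f' g')
    (s : sq x y m n) (b : obj (chom B B')) (b' : obj (chom B' B'')),
    sq_eq (s ▷s (b ⊛ b')) ((s ▷s b) ▷s b');
  cassoc_lrv : forall (A' A B B' : ccell0 C) (a : obj (chom A' A))
    (f f' : obj (chom A B)) (x : arr f f') (b : obj (chom B B')),
    heq2 ((a ◁v x) ▷v b) (a ◁v (x ▷v b));
  cassoc_lrh : forall (A' A B B' : ccell0 C) (a : obj (chom A' A))
    (f f' : obj (chom A B)) (x : pro f f') (b : obj (chom B B')),
    heq2 ((a ◁h x) ▷h b) (a ◁h (x ▷h b));
  cassoc_lrs : forall (A' A B B' : ccell0 C) (a : obj (chom A' A))
    (f g f' g' : obj (chom A B))
    (x : arr f f') (y : arr g g') (m : pro f g) (n : pro f' g')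
    (s : sq x y m n) (b : obj (chom B B')),
    sq_eq ((a ◁s s) ▷s b) (a ◁s (s ▷s b));
  cleft_strict : forall (A' A B : ccell0 C) (a : obj (chom A' A)),
    @strict_double_functor (chom A B) (chom A' B) (fun f => a ⊛ f)
      (fun _ _ x => a ◁v x) (fun _ _ x => a ◁h x)
      (fun _ _ _ _ _ _ _ _ s => a ◁s s);
  cright_strict : forall (A B B' : ccell0 C) (b : obj (chom B B')),
    @strict_double_functor (chom A B) (chom A B') (fun f => f ⊛ b)
      (fun _ _ x => x ▷v b) (fun _ _ x => x ▷h b)
      (fun _ _ _ _ _ _ _ _ s => s ▷s b)
}.

Record cubical_chi_laws (C : cubical_ops) : Prop := CubicalChiLaws {
  chi_vh_l : forall (A' A B E : ccell0 C) (a : obj (chom A' A))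
    (f f' : obj (chom A B)) (g g' : obj (chom B E))
    (x : arr f f') (d : pro g g'),
    sq_eq (chi_vh (a ◁v x) d) (a ◁s chi_vh x d);
  chi_hv_l : forall (A' A B E : ccell0 C) (a : obj (chom A' A))
    (f f' : obj (chom A B)) (g g' : obj (chom B E))
    (c : pro f f') (y : arr g g'),
    sq_eq (chi_hv (a ◁h c) y) (a ◁s chi_hv c y);
  chi_vv_l : forall (A' A B E : ccell0 C) (a : obj (chom A' A))
    (f f' : obj (chom A B)) (g g' : obj (chom B E))
    (x : arr f f') (y : arr g g'),
    sq_eq (chi_vv (a ◁v x) y) (a ◁s chi_vv x y);
  chi_hh_l : forall (A' A B E : ccell0 C) (a : obj (chom A' A))
    (f f' : obj (chom A B)) (g g' : obj (chom B E))
    (c : pro f f') (d : pro g g'),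
    sq_eq (chi_hh (a ◁h c) d) (a ◁s chi_hh c d);
  chi_vh_r : forall (A B E E' : ccell0 C)
    (f f' : obj (chom A B)) (g g' : obj (chom B E)) (c : obj (chom E E'))
    (x : arr f f') (d : pro g g'),
    sq_eq (chi_vh x (d ▷h c)) (chi_vh x d ▷s c);
  chi_hv_r : forall (A B E E' : ccell0 C)
    (f f' : obj (chom A B)) (g g' : obj (chom B E)) (c : obj (chom E E'))
    (m : pro f f') (y : arr g g'),
    sq_eq (chi_hv m (y ▷v c)) (chi_hv m y ▷s c);
  chi_vv_r : forall (A B E E' : ccell0 C)
    (f f' : obj (chom A B)) (g g' : obj (chom B E)) (c : obj (chom E E'))
    (x : arr f f') (y : arr g g'),
    sq_eq (chi_vv x (y ▷v c)) (chi_vv x y ▷s c);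
  chi_hh_r : forall (A B E E' : ccell0 C)
    (f f' : obj (chom A B)) (g g' : obj (chom B E)) (c : obj (chom E E'))
    (m : pro f f') (d : pro g g'),
    sq_eq (chi_hh m (d ▷h c)) (chi_hh m d ▷s c);
  chi_vh_m : forall (A B B' E : ccell0 C)
    (f f' : obj (chom A B)) (b : obj (chom B B')) (g g' : obj (chom B' E))
    (x : arr f f') (d : pro g g'),
    sq_eq (chi_vh (x ▷v b) d) (chi_vh x (b ◁h d));
  chi_hv_m : forall (A B B' E : ccell0 C)
    (f f' : obj (chom A B)) (b : obj (chom B B')) (g g' : obj (chom B' E))
    (c : pro f f') (y : arr g g'),
    sq_eq (chi_hv (c ▷h b) y) (chi_hv c (b ◁v y));
  chi_vv_m : forall (A B B' E : ccell0 C)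
    (f f' : obj (chom A B)) (b : obj (chom B B')) (g g' : obj (chom B' E))
    (x : arr f f') (y : arr g g'),
    sq_eq (chi_vv (x ▷v b) y) (chi_vv x (b ◁v y));
  chi_hh_m : forall (A B B' E : ccell0 C)
    (f f' : obj (chom A B)) (b : obj (chom B B')) (g g' : obj (chom B' E))
    (c : pro f f') (d : pro g g'),
    sq_eq (chi_hh (c ▷h b) d) (chi_hh c (b ◁h d));
  chi_vh_id : forall (A B E : ccell0 C) (f : obj (chom A B))
    (g g' : obj (chom B E)) (d : pro g g'),
    sq_eq (chi_vh (aid f) d) (sid (f ◁h d));
  chi_vh_comp : forall (A B E : ccell0 C) (f f' f'' : obj (chom A B))
    (g g' : obj (chom B E)) (x : arr f f') (x' : arr f' f'') (d : pro g g'),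
    sq_eq (chi_vh (x · x') d) (chi_vh x d ·□ chi_vh x' d);
  chi_vh_unit : forall (A B E : ccell0 C) (f f' : obj (chom A B))
    (g : obj (chom B E)) (x : arr f f'),
    sq_eq (chi_vh x (punit g)) (sunit (x ▷v g));
  chi_vh_pcomp : forall (A B E : ccell0 C) (f f' : obj (chom A B))
    (g g' g'' : obj (chom B E)) (x : arr f f')
    (d : pro g g') (d' : pro g' g''),
    sq_eq (chi_vh x (d ⊙ d')) (chi_vh x d ⊙□ chi_vh x d');
  chi_hv_unit : forall (A B E : ccell0 C) (f : obj (chom A B))
    (g g' : obj (chom B E)) (y : arr g g'),
    sq_eq (chi_hv (punit f) y) (sunit (f ◁v y));
  chi_hv_pcomp : forall (A B E : ccell0 C) (f f' f'' : obj (chom A B))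
    (g g' : obj (chom B E)) (c : pro f f') (c' : pro f' f'') (y : arr g g'),
    sq_eq (chi_hv (c ⊙ c') y) (chi_hv c y ⊙□ chi_hv c' y);
  chi_hv_id : forall (A B E : ccell0 C) (f f' : obj (chom A B))
    (g : obj (chom B E)) (c : pro f f'),
    sq_eq (chi_hv c (aid g)) (sid (c ▷h g));
  chi_hv_comp : forall (A B E : ccell0 C) (f f' : obj (chom A B))
    (g g' g'' : obj (chom B E)) (c : pro f f')
    (y : arr g g') (y' : arr g' g''),
    sq_eq (chi_hv c (y · y')) (chi_hv c y ·□ chi_hv c y');
  chi_vv_id_l : forall (A B E : ccell0 C) (f : obj (chom A B))
    (g g' : obj (chom B E)) (y : arr g g'),
    sq_eq (chi_vv (aid f) y) (sunit (f ◁v y));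
  chi_vv_id_r : forall (A B E : ccell0 C) (f f' : obj (chom A B))
    (g : obj (chom B E)) (x : arr f f'),
    sq_eq (chi_vv x (aid g)) (sunit (x ▷v g));
  chi_vv_comp_l : forall (A B E : ccell0 C) (f f' f'' : obj (chom A B))
    (g g' : obj (chom B E)) (x : arr f f') (x' : arr f' f'') (y : arr g g'),
    sq_eq (chi_vv (x · x') y)
      ((sunit (x ▷v g) ·□ chi_vv x' y)
       ⊙□[acompA (dlaws (chom A E)) (x ▷v g) (f' ◁v y) (x' ▷v g')]
       (chi_vv x y ·□ sunit (x' ▷v g')));
  chi_vv_comp_r : forall (A B E : ccell0 C) (f f' : obj (chom A B))
    (g g' g'' : obj (chom B E)) (x : arr f f')
    (y : arr g g') (y' : arr g' g''),
    sq_eq (chi_vv x (y · y'))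
      ((chi_vv x y ·□ sunit (f' ◁v y'))
       ⊙□[esym (acompA (dlaws (chom A E)) (f ◁v y) (x ▷v g') (f' ◁v y'))]
       (sunit (f ◁v y) ·□ chi_vv x y'));
  chi_hh_unit_l : forall (A B E : ccell0 C) (f : obj (chom A B))
    (g g' : obj (chom B E)) (d : pro g g'),
    sq_eq (chi_hh (punit f) d) (lam (f ◁h d) ·□ rho_inv (f ◁h d));
  chi_hh_unit_r : forall (A B E : ccell0 C) (f f' : obj (chom A B))
    (g : obj (chom B E)) (c : pro f f'),
    sq_eq (chi_hh c (punit g)) (rho (c ▷h g) ·□ lam_inv (c ▷h g));
  chi_hh_pcomp_l : forall (A B E : ccell0 C) (f f' f'' : obj (chom A B))
    (g g' : obj (chom B E)) (c : pro f f') (c' : pro f' f'') (d : pro g g'),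
    sq_eq (chi_hh (c ⊙ c') d)
      (kap (c ▷h g) (c' ▷h g) (f'' ◁h d)
       ·□ (sid (c ▷h g) ⊙□ chi_hh c' d)
       ·□ kap_inv (c ▷h g) (f' ◁h d) (c' ▷h g')
       ·□ (chi_hh c d ⊙□ sid (c' ▷h g'))
       ·□ kap (f ◁h d) (c ▷h g') (c' ▷h g'));
  chi_hh_pcomp_r : forall (A B E : ccell0 C) (f f' : obj (chom A B))
    (g g' g'' : obj (chom B E)) (c : pro f f')
    (d : pro g g') (d' : pro g' g''),
    sq_eq (chi_hh c (d ⊙ d'))
      (kap_inv (c ▷h g) (f' ◁h d) (f' ◁h d')
       ·□ (chi_hh c d ⊙□ sid (f' ◁h d'))
       ·□ kap (f ◁h d) (c ▷h g') (f' ◁h d')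
       ·□ (sid (f ◁h d) ⊙□ chi_hh c d')
       ·□ kap_inv (f ◁h d) (f ◁h d') (c ▷h g''));
  chi_nat_l_h : forall (A B E : ccell0 C) (f0 f1 f0' f1' : obj (chom A B))
    (x : arr f0 f0') (x' : arr f1 f1') (c : pro f0 f1) (c' : pro f0' f1')
    (s : sq x x' c c') (g g' : obj (chom B E)) (d : pro g g'),
    sq_eq (((s ▷s g) ⊙□ chi_vh x' d) ·□ chi_hh c' d)
      (chi_hh c d ·□ (chi_vh x d ⊙□ (s ▷s g')));
  chi_nat_l_v : forall (A B E : ccell0 C) (f0 f1 f0' f1' : obj (chom A B))
    (x : arr f0 f0') (x' : arr f1 f1') (c : pro f0 f1) (c' : pro f0' f1')
    (s : sq x x' c c') (g g' : obj (chom B E)) (y : arr g g'),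
    sq_cong (((s ▷s g) ·□ chi_hv c' y) ⊙□ chi_vv x' y)
      (chi_vv x y ⊙□ (chi_hv c y ·□ (s ▷s g')));
  chi_nat_r_h : forall (A B E : ccell0 C) (g0 g1 g0' g1' : obj (chom B E))
    (y : arr g0 g0') (y' : arr g1 g1') (d : pro g0 g1) (d' : pro g0' g1')
    (t : sq y y' d d') (f f' : obj (chom A B)) (c : pro f f'),
    sq_eq (chi_hh c d ·□ ((f ◁s t) ⊙□ chi_hv c y'))
      ((chi_hv c y ⊙□ (f' ◁s t)) ·□ chi_hh c d');
  chi_nat_r_v : forall (A B E : ccell0 C) (g0 g1 g0' g1' : obj (chom B E))
    (y : arr g0 g0') (y' : arr g1 g1') (d : pro g0 g1) (d' : pro g0' g1')
    (t : sq y y' d d') (f f' : obj (chom A B)) (x : arr f f'),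
    sq_cong ((chi_vh x d ·□ (f' ◁s t)) ⊙□ chi_vv x y')
      (chi_vv x y ⊙□ ((f ◁s t) ·□ chi_vh x d'))
}.

Record cubical_gray_category := CubicalGrayCategory {
  cops :> cubical_ops;
  cwhisker_laws : cubical_whisker_laws cops;
  cchi_laws : cubical_chi_laws cops
}.

Definition trivial_horizontal (C : cubical_gray_category) : Prop :=
  forall (A B : ccell0 C) (f f' : obj (chom A B)) (m : pro f f'),
    exists h : obj (chom A B), heq2 m (punit h).

Record trivial_cubical_gray_category := TrivialCubicalGrayCategory {
  tcgc :> cubical_gray_category;
  tcgc_trivial : trivial_horizontal tcgc
}.

Record two_graph := TwoGraph {
  tobj : Type;
  mor : tobj -> tobj -> Type;
  mor2 : forall {a b : tobj}, mor a b -> mor a b -> Type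
}.
Arguments mor {_} _ _.
Arguments mor2 {_ a b} _ _.

Inductive mor2_eq {T : two_graph} {a b : tobj T} {x y : mor a b}
    (s : mor2 x y) :
  forall (a' b' : tobj T) (x' y' : mor a' b'), mor2 x' y' -> Prop :=
| mor2_eq_refl : mor2_eq s s.
Arguments mor2_eq {T a b x y} s {a' b' x' y'} _.

Record two_ops := TwoOps {
  tgraph :> two_graph;
  mid : forall a : tobj tgraph, mor a a;
  mcomp : forall {a b c : tobj tgraph}, mor a b -> mor b c -> mor a c;
  id2 : forall {a b : tobj tgraph} (x : mor a b), mor2 x x;
  mcomp2 : forall {a b c : tobj tgraph} {x x' : mor a b} {y y' : mor b c},
    mor2 x x' -> mor2 y y' -> mor2 (mcomp x y) (mcomp x' y');
  comp2 : forall {a b : tobj tgraph} {x y z : mor a b},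
    mor2 x y -> mor2 y z -> mor2 x z
}.
Arguments mid {_} a.
Arguments mcomp {_ a b c} _ _.
Arguments id2 {_ a b} x.
Arguments mcomp2 {_ a b c x x' y y'} _ _.
Arguments comp2 {_ a b x y z} _ _.

Notation "x · y" := (mcomp x y) : two_scope.
Notation "s ·2 t" := (mcomp2 s t) : two_scope.
Notation "s ⊙ t" := (comp2 s t) : two_scope.

Close Scope dbl_scope.
Open Scope two_scope.

Record two_laws (T : two_ops) : Prop := TwoLaws {
  mid_l : forall (a b : tobj T) (x : mor a b), mid a · x = x;
  mid_r : forall (a b : tobj T) (x : mor a b), x · mid b = x;
  mcompA : forall (a b c d : tobj T) (x : mor a b) (y : mor b c) (z : mor c d),
    x · (y · z) = (x · y) · z;
  id2_l : forall (a b : tobj T) (x y : mor a b) (s : mor2 x y), id2 x ⊙ s = s;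
  id2_r : forall (a b : tobj T) (x y : mor a b) (s : mor2 x y), s ⊙ id2 y = s;
  comp2A : forall (a b : tobj T) (x y z w : mor a b)
    (s : mor2 x y) (t : mor2 y z) (u : mor2 z w), s ⊙ (t ⊙ u) = (s ⊙ t) ⊙ u;
  mcomp2_id2 : forall (a b c : tobj T) (x : mor a b) (y : mor b c),
    id2 x ·2 id2 y = id2 (x · y);
  mcomp2_comp2 : forall (a b c : tobj T) (x x' x'' : mor a b)
    (y y' y'' : mor b c) (s : mor2 x x') (s' : mor2 x' x'')
    (t : mor2 y y') (t' : mor2 y' y''),
    (s ⊙ s') ·2 (t ⊙ t') = (s ·2 t) ⊙ (s' ·2 t');
  mcomp2_mid_l : forall (a b : tobj T) (x y : mor a b) (s : mor2 x y),
    mor2_eq (id2 (mid a) ·2 s) s;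
  mcomp2_mid_r : forall (a b : tobj T) (x y : mor a b) (s : mor2 x y),
    mor2_eq (s ·2 id2 (mid b)) s;
  mcomp2A : forall (a b c d : tobj T) (x x' : mor a b) (y y' : mor b c)
    (z z' : mor c d) (s : mor2 x x') (t : mor2 y y') (u : mor2 z z'),
    mor2_eq (s ·2 (t ·2 u)) ((s ·2 t) ·2 u)
}.

Record two_category := TwoCategory {
  tops :> two_ops;
  tlaws : two_laws tops
}.

Definition comp2_along {T : two_ops} {a b : tobj T} {x y y' z : mor a b}
    (e : y = y') (s : mor2 x y) (t : mor2 y' z) : mor2 x z :=
  match e in _ = w return mor2 w z -> mor2 x z with
  | eq_refl => fun t => s ⊙ t
  end t.
Notation "s ⊙[ e ] t" := (comp2_along e s t) : two_scope.

Record strict_two_functor (T S : two_ops) (Fo : tobj T -> tobj S)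
    (Fm : forall a b : tobj T, mor a b -> mor (Fo a) (Fo b))
    (F2 : forall (a b : tobj T) (x y : mor a b),
      mor2 x y -> mor2 (Fm _ _ x) (Fm _ _ y)) : Prop :=
StrictTwoFunctor {
  stf_mid : forall a : tobj T, Fm a a (mid a) = mid (Fo a);
  stf_mcomp : forall (a b c : tobj T) (x : mor a b) (y : mor b c),
    Fm _ _ (x · y) = Fm _ _ x · Fm _ _ y;
  stf_id2 : forall (a b : tobj T) (x : mor a b),
    F2 _ _ _ _ (id2 x) = id2 (Fm _ _ x);
  stf_comp2 : forall (a b : tobj T) (x y z : mor a b)
    (s : mor2 x y) (t : mor2 y z),
    F2 _ _ _ _ (s ⊙ t) = F2 _ _ _ _ s ⊙ F2 _ _ _ _ t;
  stf_mcomp2 : forall (a b c : tobj T) (x x' : mor a b) (y y' : mor b c)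
    (s : mor2 x x') (t : mor2 y y'),
    mor2_eq (F2 _ _ _ _ (s ·2 t)) (F2 _ _ _ _ s ·2 F2 _ _ _ _ t)
}.

Record gray_ops := GrayOps {
  gcell0 : Type;
  ghom : gcell0 -> gcell0 -> two_category;
  gId : forall A : gcell0, tobj (ghom A A);
  gcomp : forall {A B C : gcell0},
    tobj (ghom A B) -> tobj (ghom B C) -> tobj (ghom A C);
  gl2 : forall {A B C : gcell0} (a : tobj (ghom A B)) {f f' : tobj (ghom B C)},
    mor f f' -> mor (gcomp a f) (gcomp a f');
  gr2 : forall {A B C : gcell0} {f f' : tobj (ghom A B)},
    mor f f' -> forall b : tobj (ghom B C), mor (gcomp f b) (gcomp f' b);
  gl3 : forall {A B C : gcell0} (a : tobj (ghom A B))
    {f f' : tobj (ghom B C)} {x y : mor f f'},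
    mor2 x y -> mor2 (gl2 a x) (gl2 a y);
  gr3 : forall {A B C : gcell0} {f f' : tobj (ghom A B)} {x y : mor f f'},
    mor2 x y -> forall b : tobj (ghom B C), mor2 (gr2 x b) (gr2 y b);
  gchi : forall {A B C : gcell0} {f f' : tobj (ghom A B)}
    {g g' : tobj (ghom B C)} (x : mor f f') (y : mor g g'),
    mor2 (gr2 x g · gl2 f' y) (gl2 f y · gr2 x g')
}.
Arguments ghom {_} _ _.
Arguments gId {_} A.
Arguments gcomp {_ A B C} _ _.
Arguments gl2 {_ A B C} a {f f'} _.
Arguments gr2 {_ A B C f f'} _ b.
Arguments gl3 {_ A B C} a {f f' x y} _.
Arguments gr3 {_ A B C f f' x y} _ b.
Arguments gchi {_ A B C f f' g g'} x y.

Notation "f ⊛ g" := (gcomp f g) : two_scope.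
Notation "a ◁2 x" := (gl2 a x) : two_scope.
Notation "x ▷2 b" := (gr2 x b) : two_scope.
Notation "a ◁3 x" := (gl3 a x) : two_scope.
Notation "x ▷3 b" := (gr3 x b) : two_scope.

Record gray_laws (G : gray_ops) : Prop := GrayLaws {
  gid_l1 : forall (A B : gcell0 G) (f : tobj (ghom A B)), gId A ⊛ f = f;
  gid_r1 : forall (A B : gcell0 G) (f : tobj (ghom A B)), f ⊛ gId B = f;
  gassoc1 : forall (X A B Y : gcell0 G) (f : tobj (ghom X A))
    (g : tobj (ghom A B)) (h : tobj (ghom B Y)), f ⊛ (g ⊛ h) = (f ⊛ g) ⊛ h;
  gid_l2 : forall (A B : gcell0 G) (f f' : tobj (ghom A B)) (x : mor f f'),
    heq2 (gId A ◁2 x) x;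
  gid_r2 : forall (A B : gcell0 G) (f f' : tobj (ghom A B)) (x : mor f f'),
    heq2 (x ▷2 gId B) x;
  gid_l3 : forall (A B : gcell0 G) (f f' : tobj (ghom A B)) (x y : mor f f')
    (s : mor2 x y), mor2_eq (gId A ◁3 s) s;
  gid_r3 : forall (A B : gcell0 G) (f f' : tobj (ghom A B)) (x y : mor f f')
    (s : mor2 x y), mor2_eq (s ▷3 gId B) s;
  gassoc_ll2 : forall (A'' A' A B : gcell0 G) (a' : tobj (ghom A'' A'))
    (a : tobj (ghom A' A)) (f f' : tobj (ghom A B)) (x : mor f f'),
    heq2 ((a' ⊛ a) ◁2 x) (a' ◁2 (a ◁2 x));
  gassoc_ll3 : forall (A'' A' A B : gcell0 G) (a' : tobj (ghom A'' A'))
    (a : tobj (ghom A' A)) (f f' : tobj (ghom A B)) (x y : mor f f')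
    (s : mor2 x y), mor2_eq ((a' ⊛ a) ◁3 s) (a' ◁3 (a ◁3 s));
  gassoc_rr2 : forall (A B B' B'' : gcell0 G) (f f' : tobj (ghom A B))
    (x : mor f f') (b : tobj (ghom B B')) (b' : tobj (ghom B' B'')),
    heq2 (x ▷2 (b ⊛ b')) ((x ▷2 b) ▷2 b');
  gassoc_rr3 : forall (A B B' B'' : gcell0 G) (f f' : tobj (ghom A B))
    (x y : mor f f') (s : mor2 x y)
    (b : tobj (ghom B B')) (b' : tobj (ghom B' B'')),
    mor2_eq (s ▷3 (b ⊛ b')) ((s ▷3 b) ▷3 b');
  gassoc_lr2 : forall (A' A B B' : gcell0 G) (a : tobj (ghom A' A))
    (f f' : tobj (ghom A B)) (x : mor f f') (b : tobj (ghom B B')),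
    heq2 ((a ◁2 x) ▷2 b) (a ◁2 (x ▷2 b));
  gassoc_lr3 : forall (A' A B B' : gcell0 G) (a : tobj (ghom A' A))
    (f f' : tobj (ghom A B)) (x y : mor f f') (s : mor2 x y)
    (b : tobj (ghom B B')), mor2_eq ((a ◁3 s) ▷3 b) (a ◁3 (s ▷3 b));
  gleft_strict : forall (A' A B : gcell0 G) (a : tobj (ghom A' A)),
    @strict_two_functor (ghom A B) (ghom A' B) (fun f => a ⊛ f)
      (fun _ _ x => a ◁2 x) (fun _ _ _ _ s => a ◁3 s);
  gright_strict : forall (A B B' : gcell0 G) (b : tobj (ghom B B')),
    @strict_two_functor (ghom A B) (ghom A B') (fun f => f ⊛ b)
      (fun _ _ x => x ▷2 b) (fun _ _ _ _ s => s ▷3 b);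
  gchi_l : forall (A' A B E : gcell0 G) (a : tobj (ghom A' A))
    (f f' : tobj (ghom A B)) (g g' : tobj (ghom B E))
    (x : mor f f') (y : mor g g'),
    mor2_eq (gchi (a ◁2 x) y) (a ◁3 gchi x y);
  gchi_r : forall (A B E E' : gcell0 G)
    (f f' : tobj (ghom A B)) (g g' : tobj (ghom B E)) (c : tobj (ghom E E'))
    (x : mor f f') (y : mor g g'),
    mor2_eq (gchi x (y ▷2 c)) (gchi x y ▷3 c);
  gchi_m : forall (A B B' E : gcell0 G)
    (f f' : tobj (ghom A B)) (b : tobj (ghom B B')) (g g' : tobj (ghom B' E))
    (x : mor f f') (y : mor g g'),
    mor2_eq (gchi (x ▷2 b) y) (gchi x (b ◁2 y));
  gchi_id_l : forall (A B E : gcell0 G) (f : tobj (ghom A B))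
    (g g' : tobj (ghom B E)) (y : mor g g'),
    mor2_eq (gchi (mid f) y) (id2 (f ◁2 y));
  gchi_id_r : forall (A B E : gcell0 G) (f f' : tobj (ghom A B))
    (g : tobj (ghom B E)) (x : mor f f'),
    mor2_eq (gchi x (mid g)) (id2 (x ▷2 g));
  gchi_comp_l : forall (A B E : gcell0 G) (f f' f'' : tobj (ghom A B))
    (g g' : tobj (ghom B E)) (x : mor f f') (x' : mor f' f'') (y : mor g g'),
    mor2_eq (gchi (x · x') y)
      ((id2 (x ▷2 g) ·2 gchi x' y)
       ⊙[mcompA (tlaws (ghom A E)) (x ▷2 g) (f' ◁2 y) (x' ▷2 g')]
       (gchi x y ·2 id2 (x' ▷2 g')));
  gchi_comp_r : forall (A B E : gcell0 G) (f f' : tobj (ghom A B))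
    (g g' g'' : tobj (ghom B E)) (x : mor f f')
    (y : mor g g') (y' : mor g' g''),
    mor2_eq (gchi x (y · y'))
      ((gchi x y ·2 id2 (f' ◁2 y'))
       ⊙[esym (mcompA (tlaws (ghom A E)) (f ◁2 y) (x ▷2 g') (f' ◁2 y'))]
       (id2 (f ◁2 y) ·2 gchi x y'));
  gchi_nat_l : forall (A B E : gcell0 G) (f f' : tobj (ghom A B))
    (x x' : mor f f') (s : mor2 x x')
    (g g' : tobj (ghom B E)) (y : mor g g'),
    ((s ▷3 g) ·2 id2 (f' ◁2 y)) ⊙ gchi x' y =
    gchi x y ⊙ (id2 (f ◁2 y) ·2 (s ▷3 g'));
  gchi_nat_r : forall (A B E : gcell0 G) (g g' : tobj (ghom B E))
    (y y' : mor g g') (t : mor2 y y')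
    (f f' : tobj (ghom A B)) (x : mor f f'),
    gchi x y ⊙ ((f ◁3 t) ·2 id2 (x ▷2 g')) =
    (id2 (x ▷2 g) ·2 (f' ◁3 t)) ⊙ gchi x y'
}.

Record gray_category := GrayCategory {
  gops :> gray_ops;
  glaws : gray_laws gops
}.

Record gray_iso (G H : gray_category) := GrayIso {
  gi0 : gcell0 G -> gcell0 H;
  gi1 : forall {A B : gcell0 G}, tobj (ghom A B) -> tobj (ghom (gi0 A) (gi0 B));
  gi2 : forall {A B : gcell0 G} {f f' : tobj (ghom A B)},
    mor f f' -> mor (gi1 f) (gi1 f');
  gi3 : forall {A B : gcell0 G} {f f' : tobj (ghom A B)} {x y : mor f f'},
    mor2 x y -> mor2 (gi2 x) (gi2 y);
  gi0_bij : bijective gi0;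
  gi1_bij : forall A B : gcell0 G, bijective (@gi1 A B);
  gi2_bij : forall (A B : gcell0 G) (f f' : tobj (ghom A B)),
    bijective (@gi2 A B f f');
  gi3_bij : forall (A B : gcell0 G) (f f' : tobj (ghom A B)) (x y : mor f f'),
    bijective (@gi3 A B f f' x y);
  gi_strict : forall A B : gcell0 G,
    @strict_two_functor (ghom A B) (ghom (gi0 A) (gi0 B)) (@gi1 A B)
      (fun _ _ x => gi2 x) (fun _ _ _ _ s => gi3 s);
  gi_Id : forall A : gcell0 G, gi1 (gId A) = gId (gi0 A);
  gi_comp : forall (A B C : gcell0 G) (f : tobj (ghom A B))
    (g : tobj (ghom B C)), gi1 (f ⊛ g) = gi1 f ⊛ gi1 g;
  gi_l2 : forall (A B C : gcell0 G) (a : tobj (ghom A B))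
    (f f' : tobj (ghom B C)) (x : mor f f'),
    heq2 (gi2 (a ◁2 x)) (gi1 a ◁2 gi2 x);
  gi_r2 : forall (A B C : gcell0 G) (f f' : tobj (ghom A B)) (x : mor f f')
    (b : tobj (ghom B C)), heq2 (gi2 (x ▷2 b)) (gi2 x ▷2 gi1 b);
  gi_l3 : forall (A B C : gcell0 G) (a : tobj (ghom A B))
    (f f' : tobj (ghom B C)) (x y : mor f f') (s : mor2 x y),
    mor2_eq (gi3 (a ◁3 s)) (gi1 a ◁3 gi3 s);
  gi_r3 : forall (A B C : gcell0 G) (f f' : tobj (ghom A B)) (x y : mor f f')
    (s : mor2 x y) (b : tobj (ghom B C)),
    mor2_eq (gi3 (s ▷3 b)) (gi3 s ▷3 gi1 b);
  gi_chi : forall (A B C : gcell0 G) (f f' : tobj (ghom A B))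
    (g g' : tobj (ghom B C)) (x : mor f f') (y : mor g g'),
    mor2_eq (gi3 (gchi x y)) (gchi (gi2 x) (gi2 y))
}.

Close Scope two_scope.
Open Scope dbl_scope.

Record cubical_iso (C D : cubical_gray_category) := CubicalIso {
  ci0 : ccell0 C -> ccell0 D;
  ci1 : forall {A B : ccell0 C}, obj (chom A B) -> obj (chom (ci0 A) (ci0 B));
  civ : forall {A B : ccell0 C} {f f' : obj (chom A B)},
    arr f f' -> arr (ci1 f) (ci1 f');
  cih : forall {A B : ccell0 C} {f f' : obj (chom A B)},
    pro f f' -> pro (ci1 f) (ci1 f');
  cis : forall {A B : ccell0 C} {f g f' g' : obj (chom A B)}
    {x : arr f f'} {y : arr g g'} {m : pro f g} {n : pro f' g'},
    sq x y m n -> sq (civ x) (civ y) (cih m) (cih n);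
  ci0_bij : bijective ci0;
  ci1_bij : forall A B : ccell0 C, bijective (@ci1 A B);
  civ_bij : forall (A B : ccell0 C) (f f' : obj (chom A B)),
    bijective (@civ A B f f');
  cih_bij : forall (A B : ccell0 C) (f f' : obj (chom A B)),
    bijective (@cih A B f f');
  cis_bij : forall (A B : ccell0 C) (f g f' g' : obj (chom A B))
    (x : arr f f') (y : arr g g') (m : pro f g) (n : pro f' g'),
    bijective (@cis A B f g f' g' x y m n);
  ci_strict : forall A B : ccell0 C,
    @strict_double_functor (chom A B) (chom (ci0 A) (ci0 B)) (@ci1 A B)
      (fun _ _ x => civ x) (fun _ _ m => cih m)
      (fun _ _ _ _ _ _ _ _ s => cis s);
  ci_Id : forall A : ccell0 C, ci1 (cId A) = cId (ci0 A);
  ci_comp : forall (A B E : ccell0 C) (f : obj (chom A B))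
    (g : obj (chom B E)), ci1 (f ⊛ g) = ci1 f ⊛ ci1 g;
  ci_lv : forall (A B E : ccell0 C) (a : obj (chom A B))
    (f f' : obj (chom B E)) (x : arr f f'),
    heq2 (civ (a ◁v x)) (ci1 a ◁v civ x);
  ci_rv : forall (A B E : ccell0 C) (f f' : obj (chom A B)) (x : arr f f')
    (b : obj (chom B E)), heq2 (civ (x ▷v b)) (civ x ▷v ci1 b);
  ci_lh : forall (A B E : ccell0 C) (a : obj (chom A B))
    (f f' : obj (chom B E)) (x : pro f f'),
    heq2 (cih (a ◁h x)) (ci1 a ◁h cih x);
  ci_rh : forall (A B E : ccell0 C) (f f' : obj (chom A B)) (x : pro f f')
    (b : obj (chom B E)), heq2 (cih (x ▷h b)) (cih x ▷h ci1 b);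
  ci_ls : forall (A B E : ccell0 C) (a : obj (chom A B))
    (f g f' g' : obj (chom B E))
    (x : arr f f') (y : arr g g') (m : pro f g) (n : pro f' g')
    (s : sq x y m n), sq_eq (cis (a ◁s s)) (ci1 a ◁s cis s);
  ci_rs : forall (A B E : ccell0 C) (f g f' g' : obj (chom A B))
    (x : arr f f') (y : arr g g') (m : pro f g) (n : pro f' g')
    (s : sq x y m n) (b : obj (chom B E)),
    sq_eq (cis (s ▷s b)) (cis s ▷s ci1 b);
  ci_chi_vh : forall (A B E : ccell0 C) (f f' : obj (chom A B))
    (g g' : obj (chom B E)) (x : arr f f') (d : pro g g'),
    sq_eq (cis (chi_vh x d)) (chi_vh (civ x) (cih d));
  ci_chi_hv : forall (A B E : ccell0 C) (f f' : obj (chom A B))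
    (g g' : obj (chom B E)) (c : pro f f') (y : arr g g'),
    sq_eq (cis (chi_hv c y)) (chi_hv (cih c) (civ y));
  ci_chi_vv : forall (A B E : ccell0 C) (f f' : obj (chom A B))
    (g g' : obj (chom B E)) (x : arr f f') (y : arr g g'),
    sq_eq (cis (chi_vv x y)) (chi_vv (civ x) (civ y));
  ci_chi_hh : forall (A B E : ccell0 C) (f f' : obj (chom A B))
    (g g' : obj (chom B E)) (c : pro f f') (d : pro g g'),
    sq_eq (cis (chi_hh c d)) (chi_hh (cih c) (cih d))
}.

(* A one-to-one correspondence between the cells of G and those of C: 2-cells  *)
(* of G match vertical 2-cells, and 3-cells of G match squares.  As every      *)
(* horizontal 2-cell of C is a unit, the squares whose horizontal boundaries   *)
(* are units are all the 3-cells of C.                                         *)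
Record gray_cubical_correspondence
    (G : gray_category) (C : trivial_cubical_gray_category) :=
GrayCubicalCorrespondence {
  gc0 : gcell0 G -> ccell0 C;
  gc1 : forall {A B : gcell0 G}, tobj (ghom A B) -> obj (chom (gc0 A) (gc0 B));
  gc2 : forall {A B : gcell0 G} {f f' : tobj (ghom A B)},
    mor f f' -> arr (gc1 f) (gc1 f');
  gc3 : forall {A B : gcell0 G} {f f' : tobj (ghom A B)} {x y : mor f f'},
    mor2 x y -> sq (gc2 x) (gc2 y) (punit (gc1 f)) (punit (gc1 f'));
  gc0_bij : bijective gc0;
  gc1_bij : forall A B : gcell0 G, bijective (@gc1 A B);
  gc2_bij : forall (A B : gcell0 G) (f f' : tobj (ghom A B)),
    bijective (@gc2 A B f f');
  gc3_bij : forall (A B : gcell0 G) (f f' : tobj (ghom A B)) (x y : mor f f'),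
    bijective (@gc3 A B f f' x y);
  gc_mid : forall (A B : gcell0 G) (f : tobj (ghom A B)),
    gc2 (mid f) = aid (gc1 f);
  gc_mcomp : forall (A B : gcell0 G) (f f' f'' : tobj (ghom A B))
    (x : mor f f') (y : mor f' f''), gc2 (mcomp x y) = gc2 x · gc2 y;
  gc_id2 : forall (A B : gcell0 G) (f f' : tobj (ghom A B)) (x : mor f f'),
    gc3 (id2 x) = sunit (gc2 x);
  gc_comp2 : forall (A B : gcell0 G) (f f' : tobj (ghom A B))
    (x y z : mor f f') (s : mor2 x y) (t : mor2 y z),
    sq_eq (gc3 (comp2 s t)) (gc3 s ⊙□ gc3 t);
  gc_mcomp2 : forall (A B : gcell0 G) (f f' f'' : tobj (ghom A B))
    (x x' : mor f f') (y y' : mor f' f'') (s : mor2 x x') (t : mor2 y y'),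
    sq_eq (gc3 (mcomp2 s t)) (gc3 s ·□ gc3 t);
  gc_Id : forall A : gcell0 G, gc1 (gId A) = cId (gc0 A);
  gc_comp : forall (A B E : gcell0 G) (f : tobj (ghom A B))
    (g : tobj (ghom B E)), gc1 (gcomp f g) = gc1 f ⊛ gc1 g;
  gc_l2 : forall (A B E : gcell0 G) (a : tobj (ghom A B))
    (f f' : tobj (ghom B E)) (x : mor f f'),
    heq2 (gc2 (gl2 a x)) (gc1 a ◁v gc2 x);
  gc_r2 : forall (A B E : gcell0 G) (f f' : tobj (ghom A B)) (x : mor f f')
    (b : tobj (ghom B E)), heq2 (gc2 (gr2 x b)) (gc2 x ▷v gc1 b);
  gc_l3 : forall (A B E : gcell0 G) (a : tobj (ghom A B))
    (f f' : tobj (ghom B E)) (x y : mor f f') (s : mor2 x y),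
    sq_eq (gc3 (gl3 a s)) (gc1 a ◁s gc3 s);
  gc_r3 : forall (A B E : gcell0 G) (f f' : tobj (ghom A B)) (x y : mor f f')
    (s : mor2 x y) (b : tobj (ghom B E)),
    sq_eq (gc3 (gr3 s b)) (gc3 s ▷s gc1 b);
  gc_chi : forall (A B E : gcell0 G) (f f' : tobj (ghom A B))
    (g g' : tobj (ghom B E)) (x : mor f f') (y : mor g g'),
    sq_eq (gc3 (gchi x y)) (chi_vv (gc2 x) (gc2 y))
}.

Close Scope dbl_scope.

(* Main.v *)
(* A Gray category becomes a locally cubical one by taking as horizontal
   2-cells from f to f' the proofs of f = f'; path induction then turns every
   square into a 3-cell between parallel 2-cells, and each cubical law into a
   law of Gray categories or a triviality.  Conversely, the squares of a
   locally cubical Gray category whose horizontal boundaries are units form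
   the 3-cells of a Gray category: preunitarity makes lambda, rho and (by the
   triangle equation) kappa identities on units, so that composition along
   units is strict.  If every horizontal 2-cell is a unit, these squares are
   all the squares, so the two passages are mutually inverse. *)
From mathcomp Require Import ssreflect ssrfun.
From Stdlib Require Import Eqdep Program.Equality.
Require Import Defs.

Set Implicit Arguments.
Unset Strict Implicit.
Unset Printing Implicit Defensive.

Open Scope dbl_scope.

(** * Heterogeneous equality of squares and of 2-morphisms *)

Lemma heq2_elim (T : Type) (F : T -> T -> Type)
    (P : forall a b : T, F a b -> Prop) (a b a' b' : T)
    (x : F a b) (x' : F a' b') : heq2 x x' -> P a' b' x' -> P a b x.
Proof. by case. Qed.

Lemma heq2_erefl (T : Type) (a b : T) : a = b -> heq2 (erefl a) (erefl b).
Proof. by move=> ->. Qed.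

Section Squares.
Variable D : double_ops.

Lemma sq_eq_sym (A B A' B' : obj D) (f : arr A A') (g : arr B B')
    (M : pro A B) (N : pro A' B') (s : sq f g M N)
    (X Y X' Y' : obj D) (h : arr X X') (k : arr Y Y')
    (P : pro X Y) (Q : pro X' Y') (t : sq h k P Q) :
  sq_eq s t -> sq_eq t s.
Proof. by case. Qed.

Lemma sq_eq_trans (A B A' B' : obj D) (f : arr A A') (g : arr B B')
    (M : pro A B) (N : pro A' B') (s : sq f g M N)
    (X Y X' Y' : obj D) (h : arr X X') (k : arr Y Y')
    (P : pro X Y) (Q : pro X' Y') (t : sq h k P Q)
    (Z W Z' W' : obj D) (p : arr Z Z') (q : arr W W')
    (R : pro Z W) (S : pro Z' W') (u : sq p q R S) :
  sq_eq s t -> sq_eq t u -> sq_eq s u.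
Proof. by move=> e; case: e u. Qed.

(** With the boundaries fixed, the index equations behind [sq_eq] are loops. Uniqueness of identity
    proofs, which [dependent destruction] relies on, makes them trivial. *)
Lemma sq_eq_eq (A B A' B' : obj D) (f : arr A A') (g : arr B B')
    (M : pro A B) (N : pro A' B') (s t : sq f g M N) : sq_eq s t -> s = t.
Proof. by move=> e; dependent destruction e. Qed.

(** The two hypotheses could identify the common edge [N] with [R] in different ways. Eliminating
    the first settles the identification, and uniqueness of identity proofs forces the second to
    agree with it. *)
Lemma scomp_cong (A B A' B' A'' B'' : obj D)
    (f : arr A A') (g : arr B B') (f' : arr A' A'') (g' : arr B' B'')
    (M : pro A B) (N : pro A' B') (P : pro A'' B'')
    (s : sq f g M N) (t : sq f' g' N P)
    (X Y X' Y' X'' Y'' : obj D)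
    (h : arr X X') (k : arr Y Y') (h' : arr X' X'') (k' : arr Y' Y'')
    (Q : pro X Y) (R : pro X' Y') (S : pro X'' Y'')
    (u : sq h k Q R) (v : sq h' k' R S) :
  sq_eq s u -> sq_eq t v -> sq_eq (s ·□ t) (u ·□ v).
Proof.
move=> e; move: X'' Y'' h' k' S v; case: e => X'' Y'' h' k' S v e.
by dependent destruction e.
Qed.

Lemma shcomp_cong (A B C A' B' C' : obj D)
    (f : arr A A') (g : arr B B') (h : arr C C')
    (M : pro A B) (M' : pro B C) (N : pro A' B') (N' : pro B' C')
    (s : sq f g M N) (t : sq g h M' N')
    (X Y Z X' Y' Z' : obj D)
    (p : arr X X') (q : arr Y Y') (r : arr Z Z')
    (P : pro X Y) (P' : pro Y Z) (Q : pro X' Y') (Q' : pro Y' Z')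
    (u : sq p q P Q) (v : sq q r P' Q') :
  sq_eq s u -> sq_eq t v -> sq_eq (s ⊙□ t) (u ⊙□ v).
Proof.
move=> e; move: Z Z' r P' Q' v; case: e => Z Z' r P' Q' v e.
by dependent destruction e.
Qed.

(** Only the proarrows move: in both uses, composites of units and images of units under a strict
    functor, the arrows already agree by conversion. *)
Definition scast (A B A' B' : obj D) (f : arr A A') (g : arr B B')
    (M M' : pro A B) (N N' : pro A' B') (eM : M = M') (eN : N = N')
    (s : sq f g M N) : sq f g M' N' :=
  match eM in _ = P, eN in _ = Q return sq f g P Q with
  | erefl, erefl => s
  end.

Lemma scastE (A B A' B' : obj D) (f : arr A A') (g : arr B B')
    (M M' : pro A B) (N N' : pro A' B') (eM : M = M') (eN : N = N')
    (s : sq f g M N) : sq_eq (scast eM eN s) s.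
Proof. by case: _ / eM; case: _ / eN. Qed.

Lemma scast_bij (A B A' B' : obj D) (f : arr A A') (g : arr B B')
    (M M' : pro A B) (N N' : pro A' B') (eM : M = M') (eN : N = N') :
  bijective (@scast A B A' B' f g M M' N N' eM eN).
Proof. by case: _ / eM; case: _ / eN; exists id. Qed.

End Squares.

Section TwoCells.
Variable T : two_ops.

Lemma mor2_eq_sym (a b : tobj T) (x y : mor a b) (s : mor2 x y)
    (a' b' : tobj T) (x' y' : mor a' b') (t : mor2 x' y') :
  mor2_eq s t -> mor2_eq t s.
Proof. by case. Qed.

Lemma mor2_eq_trans (a b : tobj T) (x y : mor a b) (s : mor2 x y)
    (a' b' : tobj T) (x' y' : mor a' b') (t : mor2 x' y')
    (a'' b'' : tobj T) (x'' y'' : mor a'' b'') (u : mor2 x'' y'') :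
  mor2_eq s t -> mor2_eq t u -> mor2_eq s u.
Proof. by move=> e; case: e u. Qed.

Lemma id2_cong (a b a' b' : tobj T) (x : mor a b) (x' : mor a' b') :
  heq2 x x' -> mor2_eq (id2 x) (id2 x').
Proof. by case. Qed.

End TwoCells.

(** * The double category of a 2-category, with equality proofs as proarrows *)

Section TrivialDoubleCategory.
Variable T : two_category.

(** A square is a 2-morphism from the left arrow, transported along both proofs, to the right arrow.
    Over [erefl] its type is [mor2 x y] by conversion. *)
Definition trivial_graph : double_graph :=
  @DoubleGraph (tobj T) (@mor T) (fun a b : tobj T => a = b)
    (fun a b a' b' (x : mor a a') (y : mor b b') (m : a = b) (n : a' = b') =>
       mor2 (match m in _ = c, n in _ = c' return mor c c' with
             | erefl, erefl => x
             end) y).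

(** This and the following operations are built by path induction and kept transparent, so that they
    reduce to operations of the 2-category once the proofs are destructed. *)
Definition trivial_sid (a b : tobj T) (m : a = b) :
  @sq trivial_graph a b a b (mid a) (mid b) m m.
Proof. destruct m; exact (id2 (mid a)). Defined.

Definition trivial_scomp (a b a' b' a'' b'' : tobj T)
    (x : mor a a') (y : mor b b') (x' : mor a' a'') (y' : mor b' b'')
    (m : a = b) (n : a' = b') (p : a'' = b'') :
  @sq trivial_graph a b a' b' x y m n ->
  @sq trivial_graph a' b' a'' b'' x' y' n p ->
  @sq trivial_graph a b a'' b'' (mcomp x x') (mcomp y y') m p.
Proof. destruct m, n, p; exact mcomp2. Defined.

Definition trivial_shcomp (a b c a' b' c' : tobj T)
    (x : mor a a') (y : mor b b') (z : mor c c')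
    (m : a = b) (m' : b = c) (n : a' = b') (n' : b' = c') :
  @sq trivial_graph a b a' b' x y m n ->
  @sq trivial_graph b c b' c' y z m' n' ->
  @sq trivial_graph a c a' c' x z (etrans m m') (etrans n n').
Proof. destruct m, m', n, n'; exact comp2. Defined.

Definition trivial_lam (a b : tobj T) (m : a = b) :
  @sq trivial_graph a b a b (mid a) (mid b) (etrans erefl m) m.
Proof. destruct m; exact (id2 (mid a)). Defined.

Definition trivial_lam_inv (a b : tobj T) (m : a = b) :
  @sq trivial_graph a b a b (mid a) (mid b) m (etrans erefl m).
Proof. destruct m; exact (id2 (mid a)). Defined.

Definition trivial_kap (a b c d : tobj T) (m : a = b) (n : b = c) (p : c = d) :
  @sq trivial_graph a d a d (mid a) (mid d)
    (etrans (etrans m n) p) (etrans m (etrans n p)).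
Proof. destruct m, n, p; exact (id2 (mid a)). Defined.

Definition trivial_kap_inv (a b c d : tobj T)
    (m : a = b) (n : b = c) (p : c = d) :
  @sq trivial_graph a d a d (mid a) (mid d)
    (etrans m (etrans n p)) (etrans (etrans m n) p).
Proof. destruct m, n, p; exact (id2 (mid a)). Defined.

Definition trivial_double_ops : double_ops :=
  @DoubleOps trivial_graph (@mid T) (@mcomp T) trivial_sid trivial_scomp
    (fun a => erefl a) (fun a b x => id2 x) (fun a b c m n => etrans m n)
    trivial_shcomp trivial_lam trivial_lam_inv trivial_sid trivial_sid
    trivial_kap trivial_kap_inv.

Lemma mor2_sq_eq (a b : tobj T) (x y : mor a b) (s : mor2 x y)
    (a' b' : tobj T) (x' y' : mor a' b') (t : mor2 x' y') :
  mor2_eq s t ->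
  @sq_eq trivial_graph a a b b x y erefl erefl s
    a' a' b' b' x' y' erefl erefl t.
Proof. by case. Qed.

Lemma sq_mor2_eq (a b : tobj T) (x y : mor a b) (s : mor2 x y)
    (a' b' : tobj T) (x' y' : mor a' b') (t : mor2 x' y') :
  @sq_eq trivial_graph a a b b x y erefl erefl s
    a' a' b' b' x' y' erefl erefl t -> mor2_eq s t.
Proof. by move=> e; dependent destruction e. Qed.

(** Path induction turns [lam], [rho] and [kap] into identity 2-morphisms on identities, which
    leaves only unit, associativity and interchange laws of a 2-category. *)
Lemma trivial_double_laws : double_laws trivial_double_ops.
Proof.
have lw := tlaws T.
split=> /=.
- exact: mid_l.
- exact: mid_r.
- exact: mcompA.
- move=> a b a' b' x y m n s; destruct m, n.
  by apply: mor2_sq_eq; apply: mcomp2_mid_l.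
- move=> a b a' b' x y m n s; destruct m, n.
  by apply: mor2_sq_eq; apply: mcomp2_mid_r.
- move=> a b a' b' a'' b'' c d x y x' y' x'' y'' m n p q s t u.
  destruct m, n, p, q.
  by apply: mor2_sq_eq; apply: mcomp2A.
- done.
- by move=> a b c x y; rewrite mcomp2_id2.
- by move=> a b c m n; destruct m, n; apply: id2_l.
- move=> a b c a' b' c' a'' b'' c'' x y z x' y' z' m n m' n' m'' n'' s t s' t'.
  destruct m, n, m', n', m'', n'' => /=; by rewrite mcomp2_comp2.
- by move=> a b m; destruct m; apply: mor2_sq_eq; apply: mcomp2_mid_l.
- by move=> a b m; destruct m; apply: mor2_sq_eq; apply: mcomp2_mid_l.
- by move=> a b m; destruct m; apply: mor2_sq_eq; apply: mcomp2_mid_l.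
- by move=> a b m; destruct m; apply: mor2_sq_eq; apply: mcomp2_mid_l.
- move=> a b c d m n p; destruct m, n, p.
  by apply: mor2_sq_eq; apply: mcomp2_mid_l.
- move=> a b c d m n p; destruct m, n, p.
  by apply: mor2_sq_eq; apply: mcomp2_mid_l.
- move=> a b a' b' x y m n s; destruct m, n => /=.
  rewrite id2_l //; apply: mor2_sq_eq.
  apply: mor2_eq_trans (mcomp2_mid_r lw _) _.
  by apply: mor2_eq_sym; apply: mcomp2_mid_l.
- move=> a b a' b' x y m n s; destruct m, n => /=.
  rewrite id2_r //; apply: mor2_sq_eq.
  apply: mor2_eq_trans (mcomp2_mid_r lw _) _.
  by apply: mor2_eq_sym; apply: mcomp2_mid_l.
- move=> a b c d a' b' c' d' x y z w m n p m' n' p' s t u.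
  destruct m, n, p, m', n', p' => /=.
  rewrite comp2A //; apply: mor2_sq_eq.
  apply: mor2_eq_trans (mcomp2_mid_r lw _) _.
  by apply: mor2_eq_sym; apply: mcomp2_mid_l.
- move=> a b c m n; destruct m, n => /=.
  by rewrite id2_l //; apply: mor2_sq_eq; apply: mcomp2_mid_l.
- move=> a b c d e m n p q; destruct m, n, p, q => /=.
  rewrite !id2_l //; apply: mor2_sq_eq.
  by apply: mor2_eq_sym; apply: mcomp2_mid_r.
- done.
- done.
- done.
Qed.

Definition trivial_double : double_category :=
  DoubleCategory trivial_double_laws.

(** The composition laws for interchangers transport along [mcompA] in a Gray category and along
    [acompA] in a cubical one. Uniqueness of identity proofs makes the choice of proof
    immaterial. *)
Lemma trivial_shcomp_along (a b : tobj T) (x y y' z : mor a b)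
    (e e' : y = y') (s : mor2 x y) (t : mor2 y' z) :
  comp2_along e s t =
  @shcomp_along trivial_double a a a b b b x y y' z
    erefl erefl erefl erefl e' s t.
Proof. by rewrite (UIP _ _ _ e e'); destruct e'. Qed.

End TrivialDoubleCategory.

(** * Strict double functors from strict 2-functors *)

Section TrivialFunctor.
Variables (T S : two_category) (Fo : tobj T -> tobj S).
Variable Fm : forall a b : tobj T, mor a b -> mor (Fo a) (Fo b).
Variable F2 : forall (a b : tobj T) (x y : mor a b),
  mor2 x y -> mor2 (Fm x) (Fm y).

Definition trivial_map (a b a' b' : tobj T) (x : mor a a') (y : mor b b')
    (m : a = b) (n : a' = b') :
  @sq (trivial_double T) a b a' b' x y m n ->
  @sq (trivial_double S) (Fo a) (Fo b) (Fo a') (Fo b') (Fm x) (Fm y)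
    (f_equal Fo m) (f_equal Fo n).
Proof. destruct m, n; exact (@F2 _ _ x y). Defined.

Lemma trivial_map_strict :
  @strict_two_functor T S Fo Fm F2 ->
  @strict_double_functor (trivial_double T) (trivial_double S) Fo Fm
    (fun _ _ m => f_equal Fo m) trivial_map.
Proof.
move=> st.
(* Over [erefl] each of [sid], [lam], [rho] and [kap] is the identity 2-morphism on an identity, so
   this one equation settles the preservation of all four. *)
have F2_id2_mid a : mor2_eq (F2 (id2 (mid a))) (id2 (mid (Fo a))).
  by rewrite (stf_id2 st) (stf_mid st).
split=> /=.
- exact: (stf_mid st).
- exact: (stf_mcomp st).
- by move=> a b m; destruct m; apply: mor2_sq_eq.
- move=> a b a' b' a'' b'' x y x' y' m n p s t; destruct m, n, p.
  by apply: mor2_sq_eq; apply: (stf_mcomp2 st).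
- done.
- by move=> a b x; rewrite (stf_id2 st).
- by move=> a b c m n; destruct m, n.
- move=> a b c a' b' c' x y z m m' n n' s t; destruct m, m', n, n' => /=.
  by rewrite (stf_comp2 st).
- by move=> a b m; destruct m; apply: mor2_sq_eq.
- by move=> a b m; destruct m; apply: mor2_sq_eq.
- by move=> a b c d m n p; destruct m, n, p; apply: mor2_sq_eq.
Qed.

Lemma trivial_map_bij (a b a' b' : tobj T) (x : mor a a') (y : mor b b')
    (m : a = b) (n : a' = b') :
  (forall (c c' : tobj T) (z w : mor c c'), bijective (@F2 c c' z w)) ->
  bijective (@trivial_map a b a' b' x y m n).
Proof. by move=> bij; destruct m, n; apply: bij. Qed.

End TrivialFunctor.

(** * The locally cubical Gray category of a Gray category *)

Section CubicalOfGray.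
Variable G : gray_category.

Definition cub_hom (A B : gcell0 G) : double_category :=
  trivial_double (ghom A B).

Definition cub_ls (A B C : gcell0 G) (a : tobj (ghom A B)) :=
  @trivial_map (ghom B C) (ghom A C) (gcomp a)
    (fun _ _ x => gl2 a x) (fun _ _ _ _ s => gl3 a s).

Definition cub_rs (A B C : gcell0 G) (f g f' g' : tobj (ghom A B))
    (x : mor f f') (y : mor g g') (m : f = g) (n : f' = g')
    (s : @sq (cub_hom A B) f g f' g' x y m n) (b : tobj (ghom B C)) :=
  @trivial_map (ghom A B) (ghom A C) (fun h => gcomp h b)
    (fun _ _ z => gr2 z b) (fun _ _ _ _ t => gr3 t b) _ _ _ _ x y m n s.

(** The unit laws for interchangers leave no choice: a horizontal argument is a unit up to path
    induction, so the interchanger is an identity. The same applies to [cub_chi_hv] and, as [lam]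
    and [rho_inv] are identities on units, to [cub_chi_hh]. *)
Definition cub_chi_vh (A B C : gcell0 G) (f f' : tobj (ghom A B))
    (g g' : tobj (ghom B C)) (x : mor f f') (d : g = g') :
  @sq (cub_hom A C) _ _ _ _ (gr2 x g) (gr2 x g')
    (f_equal (gcomp f) d) (f_equal (gcomp f') d).
Proof. destruct d; exact (id2 (gr2 x g)). Defined.

Definition cub_chi_hv (A B C : gcell0 G) (f f' : tobj (ghom A B))
    (g g' : tobj (ghom B C)) (c : f = f') (y : mor g g') :
  @sq (cub_hom A C) _ _ _ _ (gl2 f y) (gl2 f' y)
    (f_equal (fun h => gcomp h g) c) (f_equal (fun h => gcomp h g') c).
Proof. destruct c; exact (id2 (gl2 f y)). Defined.

Definition cub_chi_hh (A B C : gcell0 G) (f f' : tobj (ghom A B))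
    (g g' : tobj (ghom B C)) (c : f = f') (d : g = g') :
  @sq (cub_hom A C) _ _ _ _ (mid (gcomp f g)) (mid (gcomp f' g'))
    (etrans (f_equal (fun h => gcomp h g) c) (f_equal (gcomp f') d))
    (etrans (f_equal (gcomp f) d) (f_equal (fun h => gcomp h g') c)).
Proof. destruct c, d; exact (id2 (mid (gcomp f g))). Defined.

Definition cub_ops : cubical_ops :=
  @CubicalOps (gcell0 G) cub_hom (@gId G) (@gcomp G) (@gl2 G) (@gr2 G)
    (fun A B C a f f' (m : f = f') => f_equal (gcomp a) m)
    (fun A B C f f' (m : f = f') b => f_equal (fun h => gcomp h b) m)
    cub_ls cub_rs cub_chi_vh cub_chi_hv (@gchi G) cub_chi_hh.

Lemma cub_whisker_laws : cubical_whisker_laws cub_ops.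
Proof.
have lw := glaws G.
split=> /=.
- exact: gid_l1.
- exact: gid_r1.
- exact: gassoc1.
- exact: gid_l2.
- exact: gid_r2.
- by move=> A B f f' x; destruct x; apply: heq2_erefl; apply: gid_l1.
- by move=> A B f f' x; destruct x; apply: heq2_erefl; apply: gid_r1.
- move=> A B f g f' g' x y m n s; destruct m, n.
  by apply: mor2_sq_eq; apply: gid_l3.
- move=> A B f g f' g' x y m n s; destruct m, n.
  by apply: mor2_sq_eq; apply: gid_r3.
- exact: gassoc_ll2.
- move=> A'' A' A B a' a f f' x; destruct x; apply: heq2_erefl => /=.
  by rewrite gassoc1.
- move=> A'' A' A B a' a f g f' g' x y m n s; destruct m, n.
  by apply: mor2_sq_eq; apply: gassoc_ll3.
- exact: gassoc_rr2.
- move=> A B B' B'' f f' x b b'; destruct x; apply: heq2_erefl => /=.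
  by rewrite gassoc1.
- move=> A B B' B'' f g f' g' x y m n s b b'; destruct m, n.
  by apply: mor2_sq_eq; apply: gassoc_rr3.
- exact: gassoc_lr2.
- move=> A' A B B' a f f' x b; destruct x; apply: heq2_erefl => /=.
  by rewrite gassoc1.
- move=> A' A B B' a f g f' g' x y m n s b; destruct m, n.
  by apply: mor2_sq_eq; apply: gassoc_lr3.
- move=> A' A B a; exact: trivial_map_strict (gleft_strict lw B a).
- move=> A B B' b; exact: trivial_map_strict (gright_strict lw A b).
Qed.

(** Only the laws that mention [chi_vv] draw on those of [gchi]. In the others all interchangers are
    identities, and what remains follows from the functoriality and associativity of whiskering and
    from the laws of a 2-category. *)
Lemma cub_chi_laws : cubical_chi_laws cub_ops.
Proof.
have lw := glaws G.
(* This is what the two naturality laws for [chi_hh] become over [erefl]: both sides are [s] up to a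
   unit law for vertical composition. *)
have id2_midC (A B : gcell0 G) (f f' : tobj (ghom A B)) (x y : mor f f')
    (s : mor2 x y) : mor2_eq (id2 (mid f) ·2 s)%two (s ·2 id2 (mid f'))%two.
  apply: mor2_eq_trans (mcomp2_mid_l (tlaws _) _) _.
  by apply: mor2_eq_sym; apply: mcomp2_mid_r (tlaws _) _ _ _ _ _.
split=> /=.
- move=> A' A B E a f f' g g' x d; destruct d; apply: mor2_sq_eq => /=.
  rewrite (stf_id2 (gleft_strict lw _ _)); apply: id2_cong.
  exact: gassoc_lr2.
- move=> A' A B E a f f' g g' c y; destruct c; apply: mor2_sq_eq => /=.
  rewrite (stf_id2 (gleft_strict lw _ _)); apply: id2_cong.
  exact: gassoc_ll2.
- by move=> A' A B E a f f' g g' x y; apply: mor2_sq_eq; apply: gchi_l.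
- move=> A' A B E a f f' g g' c d; destruct c, d; apply: mor2_sq_eq => /=.
  rewrite (stf_id2 (gleft_strict lw _ _)) (stf_mid (gleft_strict lw _ _)).
  by rewrite gassoc1.
- move=> A B E E' f f' g g' c x d; destruct d; apply: mor2_sq_eq => /=.
  rewrite (stf_id2 (gright_strict lw _ _)); apply: id2_cong.
  exact: gassoc_rr2.
- move=> A B E E' f f' g g' c m y; destruct m; apply: mor2_sq_eq => /=.
  rewrite (stf_id2 (gright_strict lw _ _)); apply: id2_cong.
  by case: (gassoc_lr2 lw f y c).
- by move=> A B E E' f f' g g' c x y; apply: mor2_sq_eq; apply: gchi_r.
- move=> A B E E' f f' g g' c m d; destruct m, d; apply: mor2_sq_eq => /=.
  rewrite (stf_id2 (gright_strict lw _ _)) (stf_mid (gright_strict lw _ _)).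
  by rewrite gassoc1.
- move=> A B B' E f f' b g g' x d; destruct d; apply: mor2_sq_eq => /=.
  by apply: id2_cong; case: (gassoc_rr2 lw x b g).
- move=> A B B' E f f' b g g' c y; destruct c; apply: mor2_sq_eq => /=.
  by apply: id2_cong; apply: gassoc_ll2.
- by move=> A B B' E f f' b g g' x y; apply: mor2_sq_eq; apply: gchi_m.
- move=> A B B' E f f' b g g' c d; destruct c, d; apply: mor2_sq_eq => /=.
  by rewrite gassoc1.
- move=> A B E f g g' d; destruct d; apply: mor2_sq_eq => /=.
  by rewrite (stf_mid (gright_strict lw _ _)).
- move=> A B E f f' f'' g g' x x' d; destruct d; apply: mor2_sq_eq => /=.
  by rewrite (stf_mcomp (gright_strict lw _ _)) (mcomp2_id2 (tlaws _)).
- done.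
- move=> A B E f f' g g' g'' x d d'; destruct d, d'; apply: mor2_sq_eq => /=.
  by rewrite (id2_l (tlaws _)).
- done.
- move=> A B E f f' f'' g g' c c' y; destruct c, c'; apply: mor2_sq_eq => /=.
  by rewrite (id2_l (tlaws _)).
- move=> A B E f f' g c; destruct c; apply: mor2_sq_eq => /=.
  by rewrite (stf_mid (gleft_strict lw _ _)).
- move=> A B E f f' g g' g'' c y y'; destruct c; apply: mor2_sq_eq => /=.
  by rewrite (stf_mcomp (gleft_strict lw _ _)) (mcomp2_id2 (tlaws _)).
- by move=> A B E f g g' y; apply: mor2_sq_eq; apply: gchi_id_l.
- by move=> A B E f f' g x; apply: mor2_sq_eq; apply: gchi_id_r.
- move=> A B E f f' f'' g g' x x' y; apply: mor2_sq_eq.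
  apply: mor2_eq_trans (gchi_comp_l lw _ _ _) _.
  by rewrite (trivial_shcomp_along _ (acompA (dlaws (trivial_double _)) _ _ _)).
- move=> A B E f f' g g' g'' x y y'; apply: mor2_sq_eq.
  apply: mor2_eq_trans (gchi_comp_r lw _ _ _) _.
  by rewrite (trivial_shcomp_along _
    (esym (acompA (dlaws (trivial_double _)) _ _ _))).
- move=> A B E f g g' d; destruct d; apply: mor2_sq_eq => /=.
  by apply: mor2_eq_sym; apply: mcomp2_mid_l (tlaws _) _ _ _ _ _.
- move=> A B E f f' g c; destruct c; apply: mor2_sq_eq => /=.
  by apply: mor2_eq_sym; apply: mcomp2_mid_l (tlaws _) _ _ _ _ _.
- move=> A B E f f' f'' g g' c c' d; destruct c, c', d; apply: mor2_sq_eq => /=.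
  rewrite !(id2_l (tlaws _)) !(mcomp2_id2 (tlaws _)); apply: id2_cong.
  by rewrite !(mid_l (tlaws _)).
- move=> A B E f f' g g' g'' c d d'; destruct c, d, d'; apply: mor2_sq_eq => /=.
  rewrite !(id2_l (tlaws _)) !(mcomp2_id2 (tlaws _)); apply: id2_cong.
  by rewrite !(mid_l (tlaws _)).
- move=> A B E f0 f1 f0' f1' x x' c c' s g g' d.
  destruct c, c', d; apply: mor2_sq_eq => /=.
  rewrite (id2_l (tlaws _)) (id2_r (tlaws _)).
  by apply: mor2_eq_sym; apply: id2_midC.
- move=> A B E f0 f1 f0' f1' x x' c c' s g g' y.
  (* Over [erefl] the unitors on the two sides of [sq_cong] are the same identities, so the
     naturality law of the Gray category can be rewritten between them. *)
  destruct c, c'; rewrite /sq_cong /=.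
  by rewrite (gchi_nat_l lw).
- move=> A B E g0 g1 g0' g1' y y' d d' t f f' c.
  destruct c, d, d'; apply: mor2_sq_eq => /=.
  rewrite (id2_l (tlaws _)) (id2_r (tlaws _)).
  by apply: id2_midC.
- move=> A B E g0 g1 g0' g1' y y' d d' t f f' x.
  destruct d, d'; rewrite /sq_cong /=.
  by rewrite (gchi_nat_r lw).
Qed.

Definition cubical_of_gray : trivial_cubical_gray_category.
Proof.
exists (CubicalGrayCategory cub_whisker_laws cub_chi_laws).
by move=> A B f f' m; exists f; destruct m.
Defined.

End CubicalOfGray.

(** * The 2-category of squares between units *)

Section GlobularTwoCategory.
Variable D : double_category.

Let law := dlaws D.

Lemma sid_cong (A B : obj D) (M N : pro A B) :
  M = N -> sq_eq (sid M) (sid N).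
Proof. by move=> ->. Qed.

(* [sid P] has an unrelated boundary here because the equation
   [punit A ⊙ punit A = punit A] is only propositional. *)
Lemma sq_eq_sid_dom (A B A' B' : obj D) (f : arr A A') (g : arr B B')
    (M : pro A B) (N : pro A' B') (s : sq f g M N) (X Y : obj D)
    (P : pro X Y) :
  sq_eq s (sid P) -> sq_eq s (sid M).
Proof. by move/sq_eq_sym; case. Qed.

Lemma sq_eq_sid_cod (A B A' B' : obj D) (f : arr A A') (g : arr B B')
    (M : pro A B) (N : pro A' B') (s : sq f g M N) (X Y : obj D)
    (P : pro X Y) :
  sq_eq s (sid P) -> sq_eq s (sid N).
Proof. by move/sq_eq_sym; case. Qed.

(** Leaving [Q] independent of the boundary of [s] makes this applicable to [lam], [rho] and [kap]
    on units, whose domains are units only propositionally. *)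
Lemma scomp_sid_l (A B A' B' X Y : obj D) (f : arr A A') (g : arr B B')
    (f' : arr A' X) (g' : arr B' Y)
    (M : pro A B) (N : pro A' B') (P : pro X Y)
    (s : sq f g M N) (t : sq f' g' N P) (Z W : obj D) (Q : pro Z W) :
  sq_eq s (sid Q) -> sq_eq (s ·□ t) t.
Proof.
move/sq_eq_sid_cod=> e; apply: sq_eq_trans (sid_l law t).
by apply: scomp_cong.
Qed.

Lemma scomp_sid_r (A B A' B' X Y : obj D) (f : arr A A') (g : arr B B')
    (f' : arr A' X) (g' : arr B' Y)
    (M : pro A B) (N : pro A' B') (P : pro X Y)
    (s : sq f g M N) (t : sq f' g' N P) (Z W : obj D) (Q : pro Z W) :
  sq_eq t (sid Q) -> sq_eq (s ·□ t) s.
Proof.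
move/sq_eq_sid_dom=> e; apply: sq_eq_trans (sid_r law s).
by apply: scomp_cong.
Qed.

(** Since [lam] is an identity on a unit, [lam_inv] equals the composite [lam ·□ lam_inv], which is
    an identity. *)
Lemma lam_inv_punit (A : obj D) :
  sq_eq (lam_inv (punit A)) (sid (punit A)).
Proof.
have e := scomp_sid_l (lam_inv (punit A)) (lam_punit law A).
apply: sq_eq_trans (sq_eq_sym e) _.
apply: sq_eq_trans (lam_linv law (punit A)) _.
by apply: sid_cong; apply: punit_idem.
Qed.

Lemma rho_inv_punit (A : obj D) :
  sq_eq (rho_inv (punit A)) (sid (punit A)).
Proof.
have e := scomp_sid_l (rho_inv (punit A)) (rho_punit law A).
apply: sq_eq_trans (sq_eq_sym e) _.
apply: sq_eq_trans (rho_linv law (punit A)) _.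
by apply: sid_cong; apply: punit_idem.
Qed.

(** The unitors that [sq_cong] wraps around both squares are identities on units and cancel. The
    proarrows are units only up to equality, so that whiskered units are covered. *)
Lemma sq_cong_sq_eq (A A' : obj D) (f g : arr A A')
    (M : pro A A) (N : pro A' A')
    (s : sq f g (M ⊙ punit A) (N ⊙ punit A'))
    (t : sq f g (punit A ⊙ M) (punit A' ⊙ N)) :
  M = punit A -> N = punit A' -> sq_cong s t -> sq_eq s t.
Proof.
move=> eM eN; subst M N; rewrite /sq_cong => e.
have es := sq_eq_trans (scomp_sid_r (rho_inv _ ·□ s) (rho_punit law _))
  (scomp_sid_l s (rho_inv_punit _)).
have et := sq_eq_trans (scomp_sid_r (lam_inv _ ·□ t) (lam_punit law _))
  (scomp_sid_l t (lam_inv_punit _)).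
by apply: sq_eq_trans (sq_eq_sym es) _; rewrite e.
Qed.

(** In the triangle equation on units, [lam] and [rho] are identities, and so are their horizontal
    composites with [sid]. This leaves [kap] alone on one side and an identity on the other. *)
Lemma kap_punit (A : obj D) :
  sq_eq (kap (punit A) (punit A) (punit A)) (sid (punit A)).
Proof.
have sidU2 : sq_eq (sid (punit A ⊙ punit A)) (sid (punit A)).
  by apply: sid_cong; apply: punit_idem.
have e : sq_eq (sid (punit A) ⊙□ lam (punit A)) (sid (punit A)).
  apply: sq_eq_trans sidU2; rewrite -(shcomp_sid law).
  by apply: shcomp_cong => //; apply: lam_punit.
apply: sq_eq_trans (sq_eq_sym (scomp_sid_r _ e)) _.
apply: sq_eq_trans (triangle law _ _) _.
apply: sq_eq_trans sidU2; rewrite -(shcomp_sid law).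
by apply: shcomp_cong => //; apply: rho_punit.
Qed.

Definition glob_graph : two_graph :=
  @TwoGraph (obj D) (@arr D) (fun a b x y => sq x y (punit a) (punit b)).

(** The horizontal composite lies over [punit a ⊙ punit a] and [punit b ⊙ punit b]; preunitarity
    brings it back to units. *)
Definition glob_comp2 (a b : obj D) (x y z : arr a b)
    (s : sq x y (punit a) (punit b)) (t : sq y z (punit a) (punit b)) :
  sq x z (punit a) (punit b) :=
  scast (punit_idem law a) (punit_idem law b) (s ⊙□ t).

Lemma glob_comp2E (a b : obj D) (x y z : arr a b)
    (s : sq x y (punit a) (punit b)) (t : sq y z (punit a) (punit b)) :
  sq_eq (glob_comp2 s t) (s ⊙□ t).
Proof. exact: scastE. Qed.

Definition glob_ops : two_ops :=
  @TwoOps glob_graph (@aid D) (@acomp D) (fun a b x => sunit x)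
    (fun a b c x x' y y' s t => s ·□ t) glob_comp2.

Lemma sq_glob_eq (a b a' b' : obj D) (x y : arr a b) (x' y' : arr a' b')
    (s : sq x y (punit a) (punit b)) (t : sq x' y' (punit a') (punit b')) :
  sq_eq s t -> @mor2_eq glob_graph a b x y s a' b' x' y' t.
Proof. by move=> e; dependent destruction e. Qed.

(** The unit and associativity laws of [glob_comp2] are the naturality squares of [lam], [rho] and
    [kap], whose components at units are identities. The remaining laws hold already for squares, up
    to the casts. *)
Lemma glob_laws : two_laws glob_ops.
Proof.
split=> /=.
- exact: (aid_l law).
- exact: (aid_r law).
- exact: (acompA law).
- move=> a b x y s; apply: sq_eq_eq; apply: sq_eq_trans (glob_comp2E _ _) _.
  apply: sq_eq_trans (sq_eq_sym (scomp_sid_r _ (lam_punit law b))) _.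
  apply: sq_eq_trans (lam_nat law _) _.
  exact: scomp_sid_l (lam_punit law a).
- move=> a b x y s; apply: sq_eq_eq; apply: sq_eq_trans (glob_comp2E _ _) _.
  apply: sq_eq_trans (sq_eq_sym (scomp_sid_r _ (rho_punit law b))) _.
  apply: sq_eq_trans (rho_nat law _) _.
  exact: scomp_sid_l (rho_punit law a).
- move=> a b x y z w s t u; apply: sq_eq_eq.
  apply: sq_eq_trans (glob_comp2E _ _) _.
  apply: sq_eq_trans (shcomp_cong (sq_eq_refl _) (glob_comp2E t u)) _.
  apply: sq_eq_sym; apply: sq_eq_trans (glob_comp2E _ _) _.
  apply: sq_eq_trans (shcomp_cong (glob_comp2E s t) (sq_eq_refl _)) _.
  apply: sq_eq_trans (sq_eq_sym (scomp_sid_r _ (kap_punit b))) _.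
  apply: sq_eq_trans (kap_nat law _ _ _) _.
  exact: scomp_sid_l (kap_punit a).
- by move=> a b c x y; rewrite (sunit_acomp law).
- move=> a b c x x' x'' y y' y'' s s' t t'; apply: sq_eq_eq.
  apply: sq_eq_trans (scomp_cong (glob_comp2E s s') (glob_comp2E t t')) _.
  apply: sq_eq_sym; apply: sq_eq_trans (glob_comp2E _ _) _.
  by rewrite (shcomp_scomp law).
- move=> a b x y s; apply: sq_glob_eq; apply: scomp_sid_l.
  by rewrite (sunit_aid law).
- move=> a b x y s; apply: sq_glob_eq; apply: scomp_sid_r.
  by rewrite (sunit_aid law).
- by move=> a b c d x x' y y' z z' s t u; apply: sq_glob_eq; apply: scompA.
Qed.

Definition glob : two_category := TwoCategory glob_laws.

Lemma glob_comp2_along (a b : obj D) (x y y' z : arr a b)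
    (e e' : y = y') (s : sq x y (punit a) (punit b))
    (t : sq y' z (punit a) (punit b)) :
  sq_eq (s ⊙□[e] t) (@comp2_along glob a b x y y' z e' s t).
Proof.
by rewrite (UIP _ _ _ e e'); destruct e'; apply: sq_eq_sym; apply: glob_comp2E.
Qed.

End GlobularTwoCategory.

(** * The strict 2-functor underlying a strict double functor *)

Section GlobularFunctor.
Variables (D E : double_category) (Fo : obj D -> obj E).
Variable Fa : forall A B : obj D, arr A B -> arr (Fo A) (Fo B).
Variable Fp : forall A B : obj D, pro A B -> pro (Fo A) (Fo B).
Variable Fs : forall (A B A' B' : obj D) (f : arr A A') (g : arr B B')
  (M : pro A B) (N : pro A' B'),
  sq f g M N -> sq (Fa f) (Fa g) (Fp M) (Fp N).
Hypothesis F : @strict_double_functor D E Fo Fa Fp Fs.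

Definition glob_map (a b : obj D) (x y : arr a b)
    (s : sq x y (punit a) (punit b)) :
  sq (Fa x) (Fa y) (punit (Fo a)) (punit (Fo b)) :=
  scast (sdf_punit F a) (sdf_punit F b) (Fs s).

Lemma glob_mapE (a b : obj D) (x y : arr a b)
    (s : sq x y (punit a) (punit b)) : sq_eq (glob_map s) (Fs s).
Proof. exact: scastE. Qed.

Lemma strict_functor_cong (A B A' B' : obj D) (f : arr A A') (g : arr B B')
    (M : pro A B) (N : pro A' B') (s : sq f g M N)
    (X Y X' Y' : obj D) (h : arr X X') (k : arr Y Y')
    (P : pro X Y) (Q : pro X' Y') (t : sq h k P Q) :
  sq_eq s t -> sq_eq (Fs s) (Fs t).
Proof. by case. Qed.

Lemma glob_map_strict : @strict_two_functor (glob D) (glob E) Fo Fa glob_map.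
Proof.
split=> /=.
- exact: (sdf_aid F).
- exact: (sdf_acomp F).
- move=> a b x; apply: sq_eq_eq; apply: sq_eq_trans (glob_mapE _) _.
  exact: (sdf_sunit F).
- move=> a b x y z s t; apply: sq_eq_eq; apply: sq_eq_trans (glob_mapE _) _.
  apply: sq_eq_trans (strict_functor_cong (glob_comp2E _ _)) _.
  apply: sq_eq_trans (sdf_shcomp F _ _) _.
  apply: sq_eq_sym; apply: sq_eq_trans (glob_comp2E _ _) _.
  exact: shcomp_cong (glob_mapE s) (glob_mapE t).
- move=> a b c x x' y y' s t; apply: sq_glob_eq.
  apply: sq_eq_trans (glob_mapE _) _.
  apply: sq_eq_trans (sdf_scomp F _ _) _.
  exact: sq_eq_sym (scomp_cong (glob_mapE s) (glob_mapE t)).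
Qed.

Lemma glob_map_bij (a b : obj D) (x y : arr a b) :
  bijective (@Fs a a b b x y (punit a) (punit b)) ->
  bijective (@glob_map a b x y).
Proof. by move=> bij; apply: bij_comp (scast_bij _ _ _ _) bij. Qed.

End GlobularFunctor.

(** * The Gray category underlying a locally cubical one *)

Section GrayOfCubical.
Variable C : cubical_gray_category.

Let wl := cwhisker_laws C.
Let cl := cchi_laws C.

Definition gray_l3 (A B E : ccell0 C) (a : obj (chom A B))
    (f f' : obj (chom B E)) (x y : arr f f')
    (s : sq x y (punit f) (punit f')) :
  sq (a ◁v x) (a ◁v y) (punit (a ⊛ f)) (punit (a ⊛ f')) :=
  glob_map (cleft_strict wl E a) s.

Definition gray_r3 (A B E : ccell0 C) (f f' : obj (chom A B)) (x y : arr f f')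
    (s : sq x y (punit f) (punit f')) (b : obj (chom B E)) :
  sq (x ▷v b) (y ▷v b) (punit (f ⊛ b)) (punit (f' ⊛ b)) :=
  glob_map (cright_strict wl A b) s.

Lemma gray_l3E (A B E : ccell0 C) (a : obj (chom A B))
    (f f' : obj (chom B E)) (x y : arr f f')
    (s : sq x y (punit f) (punit f')) : sq_eq (gray_l3 a s) (a ◁s s).
Proof. exact: (glob_mapE (cleft_strict wl E a)). Qed.

Lemma gray_r3E (A B E : ccell0 C) (f f' : obj (chom A B)) (x y : arr f f')
    (s : sq x y (punit f) (punit f')) (b : obj (chom B E)) :
  sq_eq (gray_r3 s b) (s ▷s b).
Proof. exact: (glob_mapE (cright_strict wl A b)). Qed.

Lemma cls_cong (A B E : ccell0 C) (a : obj (chom A B))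
    (f g f' g' h k h' k' : obj (chom B E))
    (x : arr f f') (y : arr g g') (m : pro f g) (n : pro f' g')
    (x' : arr h h') (y' : arr k k') (m' : pro h k) (n' : pro h' k')
    (s : sq x y m n) (t : sq x' y' m' n') :
  sq_eq s t -> sq_eq (a ◁s s) (a ◁s t).
Proof. by case. Qed.

Lemma crs_cong (A B E : ccell0 C) (b : obj (chom B E))
    (f g f' g' h k h' k' : obj (chom A B))
    (x : arr f f') (y : arr g g') (m : pro f g) (n : pro f' g')
    (x' : arr h h') (y' : arr k k') (m' : pro h k) (n' : pro h' k')
    (s : sq x y m n) (t : sq x' y' m' n') :
  sq_eq s t -> sq_eq (s ▷s b) (t ▷s b).
Proof. by case. Qed.

Definition gray_ops_of_cubical : gray_ops :=
  @GrayOps (ccell0 C) (fun A B => glob (chom A B)) (@cId C) (@ccomp C)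
    (@clv C) (@crv C) gray_l3 gray_r3 (@chi_vv C).

(** Each law is a cubical law restricted to squares between units, once [gray_l3E], [gray_r3E] and
    [glob_comp2E] have removed the casts. *)
Lemma gray_laws_of_cubical : gray_laws gray_ops_of_cubical.
Proof.
split=> /=.
- exact: (cid_l1 wl).
- exact: (cid_r1 wl).
- exact: (cassoc1 wl).
- exact: (cid_lv wl).
- exact: (cid_rv wl).
- move=> A B f f' x y s; apply: sq_glob_eq.
  by apply: sq_eq_trans (gray_l3E _ _) _; apply: cid_ls.
- move=> A B f f' x y s; apply: sq_glob_eq.
  by apply: sq_eq_trans (gray_r3E _ _) _; apply: cid_rs.
- exact: (cassoc_llv wl).
- move=> A'' A' A B a' a f f' x y s; apply: sq_glob_eq.
  apply: sq_eq_trans (gray_l3E _ _) _.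
  apply: sq_eq_trans (cassoc_lls wl _ _ _) _.
  apply: sq_eq_trans (cls_cong _ (sq_eq_sym (gray_l3E _ _))) _.
  exact: sq_eq_sym (gray_l3E _ _).
- exact: (cassoc_rrv wl).
- move=> A B B' B'' f f' x y s b b'; apply: sq_glob_eq.
  apply: sq_eq_trans (gray_r3E _ _) _.
  apply: sq_eq_trans (cassoc_rrs wl _ _ _) _.
  apply: sq_eq_trans (crs_cong _ (sq_eq_sym (gray_r3E _ _))) _.
  exact: sq_eq_sym (gray_r3E _ _).
- exact: (cassoc_lrv wl).
- move=> A' A B B' a f f' x y s b; apply: sq_glob_eq.
  apply: sq_eq_trans (gray_r3E _ _) _.
  apply: sq_eq_trans (crs_cong _ (gray_l3E _ _)) _.
  apply: sq_eq_trans (cassoc_lrs wl _ _ _) _.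
  apply: sq_eq_trans (cls_cong _ (sq_eq_sym (gray_r3E _ _))) _.
  exact: sq_eq_sym (gray_l3E _ _).
- by move=> A' A B a; apply: glob_map_strict.
- by move=> A B B' b; apply: glob_map_strict.
- move=> A' A B E a f f' g g' x y; apply: sq_glob_eq.
  apply: sq_eq_trans (chi_vv_l cl _ _ _) _.
  exact: sq_eq_sym (gray_l3E _ _).
- move=> A B E E' f f' g g' c x y; apply: sq_glob_eq.
  apply: sq_eq_trans (chi_vv_r cl _ _ _) _.
  exact: sq_eq_sym (gray_r3E _ _).
- by move=> A B B' E f f' b g g' x y; apply: sq_glob_eq; apply: chi_vv_m.
- by move=> A B E f g g' y; apply: sq_glob_eq; apply: chi_vv_id_l.
- by move=> A B E f f' g x; apply: sq_glob_eq; apply: chi_vv_id_r.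
- move=> A B E f f' f'' g g' x x' y; apply: sq_glob_eq.
  apply: sq_eq_trans (chi_vv_comp_l cl _ _ _) _.
  exact: glob_comp2_along.
- move=> A B E f f' g g' g'' x y y'; apply: sq_glob_eq.
  apply: sq_eq_trans (chi_vv_comp_r cl _ _ _) _.
  exact: glob_comp2_along.
- move=> A B E f f' x x' s g g' y; apply: sq_eq_eq.
  apply: sq_eq_trans (glob_comp2E _ _) _.
  apply: sq_eq_sym; apply: sq_eq_trans (glob_comp2E _ _) _.
  (* In the cubical naturality law the proarrows are whiskered units. They are units by [sdf_punit],
     which turns [sq_cong] into [sq_eq], and [chi_hv_unit] turns the interchangers with a unit into
     the [sunit] of the Gray law. *)
  apply: sq_eq_sym; apply: sq_eq_trans _ (sq_eq_trans (sq_cong_sq_eq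
    (sdf_punit (cright_strict wl A g) f) (sdf_punit (cright_strict wl A g') f')
    (chi_nat_l_v cl s y)) _).
  + apply: shcomp_cong (sq_eq_refl _); apply: scomp_cong (gray_r3E _ _) _.
    exact: sq_eq_sym (chi_hv_unit cl _ _).
  + apply: shcomp_cong (sq_eq_refl _) _; apply: scomp_cong.
      exact: (chi_hv_unit cl).
    exact: sq_eq_sym (gray_r3E _ _).
- move=> A B E g g' y y' t f f' x; apply: sq_eq_eq.
  apply: sq_eq_trans (glob_comp2E _ _) _.
  apply: sq_eq_sym; apply: sq_eq_trans (glob_comp2E _ _) _.
  apply: sq_eq_trans _ (sq_eq_trans (sq_cong_sq_eq
    (sdf_punit (cleft_strict wl E f) g) (sdf_punit (cleft_strict wl E f') g')
    (chi_nat_r_v cl t x)) _).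
  + apply: shcomp_cong (sq_eq_refl _); apply: scomp_cong (gray_l3E _ _).
    exact: sq_eq_sym (chi_vh_unit cl _ _).
  + apply: shcomp_cong (sq_eq_refl _) _; apply: scomp_cong.
      exact: sq_eq_sym (gray_l3E _ _).
    exact: (chi_vh_unit cl).
Qed.

Definition gray_of_cubical : gray_category := GrayCategory gray_laws_of_cubical.

End GrayOfCubical.

(** * Comparison of the two passages *)

Definition unit_pro (D : double_category) (a b : obj D) (e : a = b) : pro a b :=
  match e in _ = c return pro a c with erefl => punit a end.

Definition of_unit_sq (D : double_category) (a b a' b' : obj D)
    (x : arr a a') (y : arr b b') (m : a = b) (n : a' = b') :
  @sq (trivial_double (glob D)) a b a' b' x y m n ->
  sq x y (unit_pro m) (unit_pro n).
Proof. destruct m, n; exact id. Defined.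

Lemma unit_pro_bij (C : trivial_cubical_gray_category) (A B : ccell0 C)
    (f f' : obj (chom A B)) : bijective (@unit_pro (chom A B) f f').
Proof.
have ex (m : pro f f') : exists e : f = f', unit_pro e = m.
  have [h hm] := tcgc_trivial m.
  (* The claim is abstracted over both ends of the proarrow, so that it can be checked at [punit h],
     where the ends coincide and [erefl] is a witness. *)
  pose P a b (n : @pro (chom A B) a b) := exists e : a = b, unit_pro e = n.
  by apply: (heq2_elim (P := P) hm); exists erefl.
(* The inverse can be read off from an existence proof because its value, a proof of [f = f'], is
   itself in [Prop]. *)
exists (fun m => let: ex_intro e _ := ex m in e).
- by move=> e; apply: UIP.
- by move=> m; case: (ex m).
Qed.

Lemma of_unit_sq_bij (D : double_category) (a b a' b' : obj D)
    (x : arr a a') (y : arr b b') (m : a = b) (n : a' = b') :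
  bijective (@of_unit_sq D a b a' b' x y m n).
Proof. by destruct m, n; exists id. Qed.

(** Over [erefl] the structure cells of the source are identities, so their preservation amounts to
    [lam], [rho] and [kap] being identities on units: preunitarity and [kap_punit]. *)
Lemma of_unit_sq_strict (D : double_category) :
  @strict_double_functor (trivial_double (glob D)) D id (fun _ _ x => x)
    (@unit_pro D) (@of_unit_sq D).
Proof.
have law := dlaws D.
split=> //=.
- by move=> a b m; destruct m; rewrite /= (sunit_aid law).
- move=> a b a' b' a'' b'' x y x' y' m n p s t.
  by destruct m, n, p.
- move=> a b c m n; destruct m, n => /=.
  by rewrite (punit_idem law).
- move=> a b c a' b' c' x y z m m' n n' s t; destruct m, m', n, n' => /=.
  exact: glob_comp2E.
- move=> a b m; destruct m; rewrite /= (sunit_aid law).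
  exact: sq_eq_sym (lam_punit law a).
- move=> a b m; destruct m; rewrite /= (sunit_aid law).
  exact: sq_eq_sym (rho_punit law a).
- move=> a b c d m n p; destruct m, n, p; rewrite /= (sunit_aid law).
  exact: sq_eq_sym (kap_punit a).
Qed.

(** Squares over [erefl] are 3-cells by conversion, so all the maps are identities and the
    operations agree by conversion. *)
Definition cubical_of_gray_correspondence (G : gray_category) :
  gray_cubical_correspondence G (cubical_of_gray G).
Proof.
by exists id (fun _ _ => id) (fun _ _ _ _ => id) (fun _ _ _ _ _ _ => id);
  try by [exists id | move=> *; exists id].
Defined.

Definition gray_of_cubical_correspondence (C : trivial_cubical_gray_category) :
  gray_cubical_correspondence (gray_of_cubical C) C.
Proof.
exists id (fun _ _ => id) (fun _ _ _ _ => id) (fun _ _ _ _ _ _ => id) => //=;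
  try by [exists id | move=> *; exists id].
- by move=> *; apply: glob_comp2E.
- by move=> *; apply: gray_l3E.
- by move=> *; apply: gray_r3E.
Defined.

(** The cells on both sides coincide by conversion. Only horizontal composition and the whiskering
    of 3-cells differ, by casts along opaque equality proofs. *)
Definition gray_of_cubical_of_gray (G : gray_category) :
  gray_iso (gray_of_cubical (cubical_of_gray G)) G.
Proof.
apply: (@GrayIso (gray_of_cubical (cubical_of_gray G)) G id (fun _ _ => id)
  (fun _ _ _ _ => id) (fun _ _ _ _ _ _ => id)) => //=;
  try by [exists id | move=> *; exists id].
- move=> A B; split=> //= a b x y z s t.
  apply: (@sq_eq_eq (trivial_double _) a a b b x z erefl erefl).
  exact: (@glob_comp2E (trivial_double _)).
- move=> A B E a f f' x y s; apply: sq_mor2_eq.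
  exact: (@gray_l3E (cubical_of_gray G)).
- move=> A B E f f' x y s b; apply: sq_mor2_eq.
  exact: (@gray_r3E (cubical_of_gray G)).
Defined.

(** Triviality of [C] enters through [unit_pro_bij]: every horizontal 2-cell comes from a proof that
    its ends are equal. *)
Definition cubical_of_gray_of_cubical (C : trivial_cubical_gray_category) :
  cubical_iso (cubical_of_gray (gray_of_cubical C)) C.
Proof.
have wl := cwhisker_laws C; have cl := cchi_laws C.
apply: (@CubicalIso (cubical_of_gray (gray_of_cubical C)) C id (fun _ _ => id)
  (fun _ _ _ _ => id) (fun A B => @unit_pro (@chom C A B))
  (fun A B => @of_unit_sq (@chom C A B))) => //=;
  try by [exists id | move=> *; exists id].
- move=> A B f f'; exact: unit_pro_bij.
- move=> *; exact: of_unit_sq_bij.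
- move=> A B; exact: of_unit_sq_strict.
- move=> A B E a f f' m; destruct m => /=.
  by rewrite (sdf_punit (cleft_strict wl E a)).
- move=> A B E f f' m b; destruct m => /=.
  by rewrite (sdf_punit (cright_strict wl A b)).
- move=> A B E a f g f' g' x y m n s; destruct m, n; exact: gray_l3E.
- move=> A B E f g f' g' x y m n s b; destruct m, n; exact: gray_r3E.
- move=> A B E f f' g g' x d; destruct d.
  exact: sq_eq_sym (chi_vh_unit cl _ _).
- move=> A B E f f' g g' c y; destruct c.
  exact: sq_eq_sym (chi_hv_unit cl _ _).
(* On two units [chi_hh] is [lam ·□ rho_inv] by its unit law, and both factors are identities by
   preunitarity. *)
- move=> A B E f f' g g' c d; destruct c, d => /=.
  apply: sq_eq_sym; apply: sq_eq_trans (chi_hh_unit_l cl _ _) _.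
  rewrite (sdf_punit (cleft_strict wl E f)) (sunit_aid (dlaws _)).
  apply: sq_eq_trans (scomp_sid_l _ (lam_punit (dlaws _) _)) _.
  exact: rho_inv_punit.
Defined.

(** * Action of the two passages on isomorphisms *)

Definition cubical_of_gray_iso (G G' : gray_category) :
  gray_iso G G' -> cubical_iso (cubical_of_gray G) (cubical_of_gray G').
Proof.
move=> i.
have gi3_id2 (A B : gcell0 G) (f f' : tobj (ghom A B)) (x : mor f f') :
    gi3 i (id2 x) = id2 (gi2 i x).
  exact: (stf_id2 (gi_strict i A B)).
apply: (@CubicalIso (cubical_of_gray G) (cubical_of_gray G') (gi0 i)
  (@gi1 _ _ i) (@gi2 _ _ i) (fun A B f f' (m : f = f') => f_equal (gi1 i) m)
  (fun A B => @trivial_map (ghom A B) _ (@gi1 _ _ i A B) (@gi2 _ _ i A B)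
                (@gi3 _ _ i A B)))
  => /=.
- exact: gi0_bij.
- exact: gi1_bij.
- exact: gi2_bij.
(* On equality proofs, [f_equal] is inverted by the injectivity of [gi1]; both cancellation laws are
   uniqueness of identity proofs. *)
- move=> A B f f'; have inj := bij_inj (gi1_bij i A B).
  by exists (fun e => inj f f' e) => e; apply: UIP.
- move=> A B f g f' g' x y m n; apply: trivial_map_bij; exact: gi3_bij.
- move=> A B; apply: trivial_map_strict; exact: gi_strict.
- exact: gi_Id.
- exact: gi_comp.
- exact: gi_l2.
- exact: gi_r2.
- move=> A B E a f f' m; destruct m; apply: heq2_erefl; exact: gi_comp.
- move=> A B E f f' m b; destruct m; apply: heq2_erefl; exact: gi_comp.
- move=> A B E a f g f' g' x y m n s; destruct m, n.
  by apply: mor2_sq_eq; apply: gi_l3.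
- move=> A B E f g f' g' x y m n s b; destruct m, n.
  by apply: mor2_sq_eq; apply: gi_r3.
- move=> A B E f f' g g' x d; destruct d; apply: mor2_sq_eq => /=.
  by rewrite gi3_id2; apply: id2_cong; apply: gi_r2.
- move=> A B E f f' g g' c y; destruct c; apply: mor2_sq_eq => /=.
  by rewrite gi3_id2; apply: id2_cong; apply: gi_l2.
- by move=> A B E f f' g g' x y; apply: mor2_sq_eq; apply: gi_chi.
- move=> A B E f f' g g' c d; destruct c, d; apply: mor2_sq_eq => /=.
  by rewrite gi3_id2 (stf_mid (gi_strict i _ _)) gi_comp.
Defined.

(** A strict double functor preserves units, so the bijection on squares restricts to squares
    between units. The restriction is [glob_map], whose cast [mapE] removes. *)
Definition gray_of_cubical_iso (C C' : cubical_gray_category) :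
  cubical_iso C C' -> gray_iso (gray_of_cubical C) (gray_of_cubical C').
Proof.
move=> i.
have mapE (A B : ccell0 C) (f f' : obj (chom A B)) (x y : arr f f')
    (s : sq x y (punit f) (punit f')) :
    sq_eq (glob_map (ci_strict i A B) s) (cis i s).
  exact: glob_mapE.
have cis_cong (A B : ccell0 C) (f g f' g' h k h' k' : obj (chom A B))
    (x : arr f f') (y : arr g g') (m : pro f g) (n : pro f' g')
    (x' : arr h h') (y' : arr k k') (m' : pro h k) (n' : pro h' k')
    (s : sq x y m n) (t : sq x' y' m' n') :
    sq_eq s t -> sq_eq (cis i s) (cis i t).
  by case.
apply: (@GrayIso (gray_of_cubical C) (gray_of_cubical C') (ci0 i)
  (@ci1 _ _ i) (@civ _ _ i) (fun A B => glob_map (ci_strict i A B))) => /=.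
- exact: ci0_bij.
- exact: ci1_bij.
- exact: civ_bij.
- move=> A B f f' x y; apply: glob_map_bij; exact: cis_bij.
- move=> A B; exact: glob_map_strict.
- exact: ci_Id.
- exact: ci_comp.
- exact: ci_lv.
- exact: ci_rv.
- move=> A B E a f f' x y s; apply: sq_glob_eq.
  apply: sq_eq_trans (mapE _ _ _ _ _ _ _) _.
  apply: sq_eq_trans (cis_cong _ _ _ _ _ _ _ _ _ _ _ _ _ _ _ _ _ _ _ _
    (gray_l3E _ _)) _.
  apply: sq_eq_trans (ci_ls i _ _) _.
  apply: sq_eq_sym; apply: sq_eq_trans (gray_l3E _ _) _.
  exact: cls_cong (mapE _ _ _ _ _ _ _).
- move=> A B E f f' x y s b; apply: sq_glob_eq.
  apply: sq_eq_trans (mapE _ _ _ _ _ _ _) _.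
  apply: sq_eq_trans (cis_cong _ _ _ _ _ _ _ _ _ _ _ _ _ _ _ _ _ _ _ _
    (gray_r3E _ _)) _.
  apply: sq_eq_trans (ci_rs i _ _) _.
  apply: sq_eq_sym; apply: sq_eq_trans (gray_r3E _ _) _.
  exact: crs_cong (mapE _ _ _ _ _ _ _).
- move=> A B E f f' g g' x y; apply: sq_glob_eq.
  apply: sq_eq_trans (mapE _ _ _ _ _ _ _) _.
  exact: ci_chi_vv.
Defined.

(** Mutual inverseness is expressed by isomorphisms of structures, and the two correspondences tie
    the passages down cell by cell, beyond a mere bijection between isomorphism classes. *)
Theorem proposition3p8 :
  exists (Phi : gray_category -> trivial_cubical_gray_category)
         (Psi : trivial_cubical_gray_category -> gray_category),
    (forall G : gray_category,
       inhabited (gray_cubical_correspondence G (Phi G))) /\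
    (forall C : trivial_cubical_gray_category,
       inhabited (gray_cubical_correspondence (Psi C) C)) /\
    (forall G : gray_category, inhabited (gray_iso (Psi (Phi G)) G)) /\
    (forall C : trivial_cubical_gray_category,
       inhabited (cubical_iso (Phi (Psi C)) C)) /\
    (forall G G' : gray_category, inhabited (gray_iso G G') ->
       inhabited (cubical_iso (Phi G) (Phi G'))) /\
    (forall C C' : trivial_cubical_gray_category, inhabited (cubical_iso C C') ->
       inhabited (gray_iso (Psi C) (Psi C'))).
Proof.
(* The abstraction over [C] inserts the coercion from [trivial_cubical_gray_category]. *)
exists cubical_of_gray, (fun C => gray_of_cubical C).
split; first by move=> G; exists; apply: cubical_of_gray_correspondence.
split; first by move=> C; exists; apply: gray_of_cubical_correspondence.
split; first by move=> G; exists; apply: gray_of_cubical_of_gray.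
split; first by move=> C; exists; apply: cubical_of_gray_of_cubical.
split; first by move=> G G' [i]; exists; apply: cubical_of_gray_iso.
by move=> C C' [i]; exists; apply: gray_of_cubical_iso.
Qed.
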